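(* Let $0\le p\le1$ and let $B\ge2$ be a fixed integer. Consider a random instance $\mathcal{I}$ in $F(n,m,B,pP_{(1,1)}+(1-p)P_{(2)})$ with $m=m(n)$ and $m/n\to r$. Then the satisfiability threshold of this model is $1$: if $r<1$, $\mathcal{I}$ is SAT w.h.p., and if $r>1$, $\mathcal{I}$ is UNSAT w.h.p.
   Context: There are $n$ Boolean variables partitioned into $B$ communities of equal size $n/B$, $\mathcal{C}_i=\{v_j:(i-1)n/B+1\le j\le in/B\}$. A clause $l_1\lor l_2$ has two literals (variable or negation) on distinct variables. $P_{(2)}$ is the uniform probability measure on all such clauses whose two variables lie in the same community; $P_{(1,1)}$ is the uniform probability measure on all such clauses whose two variables lie in two distinct communities. $F(n,m,B,P)$ is the space of instances (conjunctions) of $m$ clauses drawn independently according to $P$. An instance is SAT if some truth assignment satisfies it, UNSAT otherwise. W.h.p. means with probability tending to $1$ as $n\to\infty$. *)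

(* Defs.v *)
From HB Require Import structures.
From mathcomp Require Import all_boot all_order all_algebra.
From mathcomp Require Import all_classical all_reals all_analysis.
Import numFieldNormedType.Exports.

Set Implicit Arguments.
Unset Strict Implicit.
Unset Printing Implicit Defensive.

Import Order.TTheory GRing.Theory Num.Theory.
Local Open Scope classical_set_scope.
Local Open Scope ring_scope.

(* The literal [(v, true)] is the variable [v], and [(v, false)] its negation. *)
Definition literal (n : nat) : finType := ('I_n * bool)%type.

Definition lit_vars (n : nat) (c : {set literal n}) : {set 'I_n} :=
  [set l.1 | l in c]%SET.

(* The disjunction [l1 \/ l2], identified with [l2 \/ l1], is the set
   [{l1, l2}]; the second conjunct says that the two variables differ. *)
Definition is_clause (n : nat) (c : {set literal n}) : bool :=
  (#|c| == 2)%N && (#|lit_vars c| == 2)%N.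

Record clause (n : nat) := Clause {
  clause_lits :> {set literal n};
  clauseP : is_clause clause_lits }.

HB.instance Definition _ (n : nat) := [isSub of clause n for @clause_lits n].
HB.instance Definition _ (n : nat) := [Countable of clause n by <:].
HB.instance Definition _ (n : nat) := [Finite of clause n by <:].

Definition clause_vars (n : nat) (c : clause n) : {set 'I_n} := lit_vars c.

(* Communities and variables are numbered from 0. *)
Definition community (n B : nat) (i : 'I_B) : {set 'I_n} :=
  [set v : 'I_n | (i * (n %/ B) <= v < i.+1 * (n %/ B))%N]%SET.

Definition same_community (n B : nat) (c : clause n) : bool :=
  [exists i : 'I_B, clause_vars c \subset community n i].

(* Since [clause_vars c] has exactly two elements and distinct communities
   are disjoint, this says that one variable lies in community [i] and the
   other one in community [j]. *)
Definition distinct_communities (n B : nat) (c : clause n) : bool :=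
  [exists i : 'I_B, exists j : 'I_B,
    [&& i != j, ~~ [disjoint clause_vars c & community n i]
      & ~~ [disjoint clause_vars c & community n j]]].

(* Probability measures on finite types are given by their mass functions.
   [uniform A] has total mass 1 as soon as [A] is nonempty; in particular
   [P2 R n B] does when [B >= 1] and [n %/ B >= 2]. *)
Definition uniform (R : realType) (T : finType) (A : {set T}) (x : T) : R :=
  (x \in A)%:R / #|A|%:R.

Definition P2 (R : realType) (n B : nat) : clause n -> R :=
  uniform R [set c : clause n | same_community B c]%SET.

Definition P11 (R : realType) (n B : nat) : clause n -> R :=
  uniform R [set c : clause n | distinct_communities B c]%SET.

Definition mixture (R : realType) (T : finType) (p : R) (P Q : T -> R)
  (x : T) : R := p * P x + (1 - p) * Q x.

Definition instance (n m : nat) : finType := (m.-tuple (clause n))%type.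

Definition F_mass (R : realType) (n m : nat) (P : clause n -> R)
  (I : instance n m) : R := \prod_(i < m) P (tnth I i).

Definition Pr (R : realType) (T : finType) (P : T -> R) (E : pred T) : R :=
  \sum_(x | E x) P x.

Definition lit_true (n : nat) (a : {ffun 'I_n -> bool}) (l : literal n) : bool :=
  a l.1 == l.2.

Definition clause_true (n : nat) (a : {ffun 'I_n -> bool}) (c : clause n) : bool :=
  [exists l : literal n, (l \in clause_lits c) && lit_true a l].

Definition SAT (n m : nat) (I : instance n m) : bool :=
  [exists a : {ffun 'I_n -> bool}, all (clause_true a) I].

Definition UNSAT (n m : nat) (I : instance n m) : bool := ~~ SAT I.

(* The model only makes sense when [B] divides [n], so every limit is taken
   along the multiples of [B]. *)
Definition multiples_oo (B : nat) : set_system nat :=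
  within [set n | (B %| n)%N] \oo.

Definition whp (R : realType) (B : nat) (m : nat -> nat)
    (P : forall n, clause n -> R)
    (E : forall n, pred (instance n (m n))) : Prop :=
  Pr (F_mass (P n)) (E n) @[n --> multiples_oo B] --> (1 : R).

(* Main.v *)
Require Import Defs.
From mathcomp Require Import all_boot all_order all_algebra.
From mathcomp Require Import all_classical all_reals all_analysis.
From mathcomp Require Import zify ring lra.
(* Classical sets shadow the finite-set lemmas of the same names. *)
From mathcomp Require Import fintype finset.
Import numFieldNormedType.Exports.
Import Order.TTheory GRing.Theory Num.Theory.
Set Implicit Arguments.
Unset Strict Implicit.
Unset Printing Implicit Defensive.
Local Open Scope ring_scope.

(** Under either measure, hence under the mixture, a given literal occurs in a
    random clause with probability [1 / n], and no clause has probability more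
    than [B / n ^ 2]. View a clause [~x \/ y] as the implications [x -> y] and
    [~y -> ~x]: the implication digraph then behaves like a random digraph with
    out-degree [m / n].

    For [r < 1], an unsatisfiable instance contains a bicycle: a chain of
    implications [a -> w_1 -> ... -> w_s -> b] on distinct variables, where [~a]
    is some [w_i] and the variable of [b] is also among those of the [w_i]. The
    expected number of bicycles is at most
    [sum_s 4 B^2 (s+1)^2 (m/n)^(s+2) / n = O(1/n)].

    For [r > 1], a depth-first search in the style of Krivelevich and Sudakov,
    run on the first [(1 + 2 eps) n] clauses, finds with probability
    [1 - exp(- Omega(n))] an implication chain of linear length. The other
    clauses, untouched by the search, make the instance unsatisfiable as soon as
    one of them negates two literals of the last half of the chain, which makes
    the first half false, and one of them has both literals in the first half.
    Two such literals lie in the same community for a positive fraction of the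
    pairs, which is enough when [p < 1]; when [p = 1] consecutive literals of the
    chain lie in distinct communities, so that the same holds for pairs in
    distinct communities. *)

(** * Clauses and weighted families of instances *)

Definition neg (n : nat) (l : literal n) : literal n := (l.1, ~~ l.2).

Lemma negK (n : nat) : involutive (@neg n).
Proof. by case=> v s; rewrite /neg /= negbK. Qed.

Lemma neg_inj (n : nat) : injective (@neg n).
Proof. exact: inv_inj (@negK n). Qed.

Lemma neg_neq (n : nat) (l : literal n) : (neg l == l) = false.
Proof. by case: l => v [] /=; rewrite xpair_eqE eqxx. Qed.

Lemma same_var (n : nat) (x y : literal n) : x.1 = y.1 -> x = y \/ x = neg y.
Proof. by case: x y => [v s] [w t] /= ->; case: s t => [] []; [left|right|right|left]. Qed.

Section Clauses.
Variable n : nat.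
Implicit Types (x y : literal n) (c : clause n).

Lemma is_clause_pair x y : is_clause [set x; y]%SET = (x.1 != y.1).
Proof.
rewrite /is_clause /lit_vars imsetU1 imset_set1 !cards2.
case: (eqVneq x y) => [->|_]; rewrite ?eqxx //=; by case: (x.1 != y.1).
Qed.

Definition mkclause x y (xy : x.1 != y.1) : clause n :=
  @Clause n [set x; y]%SET (etrans (is_clause_pair x y) xy).

Lemma val_clause_pair c x y : val c = [set x; y]%SET -> x.1 != y.1.
Proof. by move=> cE; rewrite -is_clause_pair -cE; apply: clauseP. Qed.

Lemma clause_pairP c : exists x, exists y, val c = [set x; y]%SET.
Proof.
have /andP[c2 _] := clauseP c; have /cards2P[x [y [_ cE]]] := c2.
by exists x, y; rewrite /= cE.
Qed.

Lemma clause_mem_pair c x : x \in val c -> exists y, val c = [set x; y]%SET.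
Proof.
have [y [z ->]] := clause_pairP c.
rewrite !inE => /orP[]/eqP ->; first by exists z.
by exists y; rewrite setUC.
Qed.

Lemma set2_inj (T : finType) (x y z : T) : [set x; y]%SET = [set x; z]%SET -> y = z.
Proof.
move=> e; have: y \in [set x; z]%SET by rewrite -e !inE eqxx orbT.
rewrite !inE => /orP[/eqP yx|/eqP //].
have: z \in [set x; y]%SET by rewrite e !inE eqxx orbT.
by rewrite !inE yx orbb => /eqP ->.
Qed.

Lemma clause_true_pair (a : {ffun 'I_n -> bool}) c x y :
  val c = [set x; y]%SET -> clause_true a c = lit_true a x || lit_true a y.
Proof.
rewrite /clause_true /= => ->; apply/existsP/orP => [[l]|].
  by rewrite !inE => /andP[/orP[]/eqP -> ->]; [left|right].
by case=> h; [exists x|exists y]; rewrite h !inE eqxx ?orbT.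
Qed.

Lemma lit_true_neg (a : {ffun 'I_n -> bool}) x : lit_true a (neg x) = ~~ lit_true a x.
Proof. by case: x => v [] /=; rewrite /lit_true /=; case: (a v). Qed.

End Clauses.

Definition mass (R : realType) (T : finType) (P : T -> R) (A : {set T}) : R :=
  \sum_(x in A) P x.

Section Mass.
Variables (R : realType) (T : finType) (P : T -> R).
Hypothesis P_ge0 : forall x, 0 <= P x.

Lemma mass_ge0 (A : {set T}) : 0 <= mass P A.
Proof. exact: sumr_ge0. Qed.

Lemma mass_sub (A A' : {set T}) : A \subset A' -> mass P A <= mass P A'.
Proof.
move=> sub; rewrite /mass [leRHS](big_setID A) /= (setIidPr sub) lerDl.
exact: sumr_ge0.
Qed.

Lemma mass_setD (A Q : {set T}) : mass P A = mass P (A :\: Q) + mass P (A :&: Q).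
Proof. by rewrite /mass (big_setID Q) /= addrC. Qed.

Lemma mass_gt0_ex (A : {set T}) : 0 < mass P A -> exists2 x, x \in A & 0 < P x.
Proof.
move=> A0; have [/exists_inP[x xA Px]|/exists_inPn /= h] := boolP [exists x in A, 0 < P x].
  by exists x.
move: A0; rewrite /mass big1 ?ltxx // => x /h; rewrite -leNgt => Px.
by apply/le_anti; rewrite Px P_ge0.
Qed.

Lemma mass_setU (A A' : {set T}) : [disjoint A & A'] ->
  mass P (A :|: A') = mass P A + mass P A'.
Proof. by move=> dis; rewrite /mass -bigU //=; apply: eq_bigl => x; rewrite !inE. Qed.

Lemma mass_set1 (x : T) : mass P [set x]%SET = P x.
Proof. exact: big_set1. Qed.

Lemma mass_setC (A : {set T}) : mass P [set: T]%SET = 1 -> mass P (~: A) = 1 - mass P A.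
Proof. by move=> <-; rewrite (mass_setD [set: T]%SET A) setTD setTI addrK. Qed.

Variable m : nat.

(** For [P] of total mass 1, the probability that every clause [I j] lies in [A j] and that [E]
    holds. The box [A] records what has been revealed so far: conditioning becomes shrinking the
    sets [A j]. *)
Definition box_weight (A : 'I_m -> {set T}) (E : pred {ffun 'I_m -> T}) : R :=
  \sum_(I : {ffun 'I_m -> T} | [forall j, I j \in A j] && E I) \prod_j P (I j).

Lemma box_weightT (A : 'I_m -> {set T}) :
  box_weight A predT = \prod_j mass P (A j).
Proof.
rewrite /mass bigA_distr_big_dep /box_weight.
by apply: eq_bigl => I; rewrite andbT; apply/forallP/familyP.
Qed.

Lemma box_weight_le (A A' : 'I_m -> {set T}) (E F : pred {ffun 'I_m -> T}) :
  (forall I : {ffun 'I_m -> T}, (forall j, I j \in A j) -> (forall j, 0 < P (I j)) ->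
    E I -> [forall j, I j \in A' j] && F I) ->
  box_weight A E <= box_weight A' F.
Proof.
move=> EF; rewrite /box_weight big_mkcond [leRHS]big_mkcond /=.
apply: ler_sum => I _; have w0 : 0 <= \prod_j P (I j) by exact: prodr_ge0.
case: ifP => [/andP[/forallP IA EI]|_]; last by case: ifP.
case: ifP => // /negbT nF.
have [/forallP /= pos|/forallPn[j]] := boolP [forall j, 0 < P (I j)].
  by rewrite (EF I) in nF.
rewrite -leNgt => le0; rewrite (bigD1 j) //=.
by rewrite (_ : P (I j) = 0) ?mul0r //; apply/le_anti; rewrite le0 P_ge0.
Qed.

Lemma box_weight_predU (A : 'I_m -> {set T}) (E F : pred {ffun 'I_m -> T}) :
  box_weight A (predU E F) <= box_weight A E + box_weight A F.
Proof.
rewrite /box_weight 3!(big_mkcond (fun I => _ && _)) -big_split /=.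
apply: ler_sum => I _; have w0 : 0 <= \prod_j P (I j) by exact: prodr_ge0.
by case: [forall j, _]; case: (E I); case: (F I); rewrite /= ?addr0 ?add0r // lerDl.
Qed.

Lemma box_weight_ge0 (A : 'I_m -> {set T}) (E : pred {ffun 'I_m -> T}) :
  0 <= box_weight A E.
Proof. by apply: sumr_ge0 => I _; apply: prodr_ge0. Qed.

Lemma box_weight_eq0 (A : 'I_m -> {set T}) (E : pred {ffun 'I_m -> T}) j :
  mass P (A j) = 0 -> box_weight A E <= 0.
Proof.
move=> Aj0; apply: le_trans (_ : box_weight A predT <= 0).
  by apply: box_weight_le => I IA _ _; rewrite andbT; apply/forallP.
by rewrite box_weightT (bigD1 j) //= Aj0 mul0r.
Qed.

Definition update (A : 'I_m -> {set T}) (j : 'I_m) (S : {set T}) : 'I_m -> {set T} :=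
  fun i => if i == j then S else A i.

Lemma mem_update (A : 'I_m -> {set T}) (j : 'I_m) (S : {set T}) (I : {ffun 'I_m -> T}) :
  S \subset A j ->
  [forall i, I i \in update A j S i] = [forall i, I i \in A i] && (I j \in S).
Proof.
move=> /subsetP SA; apply/forallP/andP => [h|[/forallP h hj] i]; last first.
  by rewrite /update; case: eqP => [->|_].
split; last by have := h j; rewrite /update eqxx.
apply/forallP => i; have := h i; rewrite /update.
by case: eqP => [->|//] /SA.
Qed.

(** One query: is clause [j] in [Q]? A negative answer removes [Q] from the box, a positive one
    reveals the clause entirely. *)
Lemma box_weight_split (A : 'I_m -> {set T}) (E : pred {ffun 'I_m -> T}) (j : 'I_m)
    (Q : {set T}) :
  box_weight A E = box_weight (update A j (A j :\: Q)) E
    + \sum_(x in A j :&: Q) box_weight (update A j [set x]%SET) E.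
Proof.
have -> : \sum_(x in A j :&: Q) box_weight (update A j [set x]%SET) E =
          box_weight (update A j (A j :&: Q)) E.
  rewrite /box_weight [RHS](partition_big (fun I : {ffun 'I_m -> T} => I j)
     (mem (A j :&: Q))) /=; last first.
    by move=> I; rewrite mem_update ?subsetIl // => /andP[/andP[]].
  apply: eq_bigr => x xAQ; apply: eq_bigl => I.
  rewrite !mem_update ?subsetIl ?sub1set //; last by move: xAQ; rewrite inE => /andP[].
  by rewrite in_set1; case: eqP => [->|]; rewrite ?xAQ ?andbF ?andbT.
rewrite /box_weight (bigID (fun I : {ffun 'I_m -> T} => I j \in Q)) /= addrC.
congr (_ + _); apply: eq_bigl => I; rewrite mem_update ?subsetDl ?subsetIl //.
  rewrite inE; case: [forall i, _] / forallP => [h|]//=; rewrite h /=.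
  by rewrite andbT andbC.
rewrite inE; case: [forall i, _] / forallP => [h|]//=; rewrite h /=.
by rewrite andbC.
Qed.

End Mass.

(** * Implications under a regular clause measure *)

Definition pair_clauses (n : nat) (x y : literal n) : {set clause n} :=
  [set c : clause n | val c == [set x; y]]%SET.

Definition satisfiable (n m : nat) (I : {ffun 'I_m -> clause n}) : bool :=
  [exists a : {ffun 'I_n -> bool}, [forall j, clause_true a (I j)]].

(** Seen as implications, the edges leaving [x] towards a variable outside [vs]. *)
Definition out_clauses (n : nat) (vs : seq 'I_n) (x : literal n) : {set clause n} :=
  [set c : clause n | [exists y : literal n,
     (y.1 \notin vs) && (val c == [set neg x; y])]]%SET.

(** What is kept of the clause joining two consecutive literals of a chain; when [p = 1] it forces
    their variables into distinct communities. *)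
Definition linked (R : realType) (n : nat) (P : clause n -> R) (u v : 'I_n) : bool :=
  [exists c : clause n, (0 < P c) && (clause_vars c == [set u; v])]%SET.

Lemma clause_vars_pair (n : nat) (c : clause n) x y :
  val c = [set x; y]%SET -> clause_vars c = [set x.1; y.1]%SET.
Proof. by rewrite /clause_vars /lit_vars /= => ->; rewrite imsetU1 imset_set1. Qed.

Section Regular.
Variables (R : realType) (n : nat) (P : clause n -> R) (C : R).
Hypothesis P_ge0 : forall c, 0 <= P c.
Hypothesis P_total : mass P [set: clause n]%SET = 1.
Hypothesis P_lit : forall x, mass P [set c : clause n | x \in val c]%SET = n%:R^-1.
Hypothesis P_le : forall c, P c <= C / n%:R ^+ 2.

Lemma bound_ge0 : 0 <= C / n%:R ^+ 2.
Proof.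
have [c _ _] : exists2 c, c \in [set: clause n]%SET & 0 < P c.
  by apply: mass_gt0_ex => //; rewrite P_total.
exact: le_trans (P_ge0 c) (P_le c).
Qed.

Lemma mass_pair_le (x y : literal n) : mass P (pair_clauses x y) <= C / n%:R ^+ 2.
Proof.
have [[c cP]|none] := pselect (exists c, c \in pair_clauses x y).
  rewrite (_ : pair_clauses x y = [set c]%SET) ?mass_set1 //.
  apply/setP => c'; rewrite !inE; move: cP; rewrite inE => /eqP <-.
  by apply/eqP/eqP => [/val_inj|->].
rewrite /mass big1 ?bound_ge0 // => c cP.
by case: none; exists c.
Qed.

(** A clause containing [x] determines its other literal, so the events for distinct [y] are
    disjoint. *)
Lemma sum_mass_pair_cond (Q : pred (literal n)) (x : literal n) :
  \sum_(y | Q y) mass P (pair_clauses x y) =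
  mass P [set c : clause n | [exists y, Q y && (val c == [set x; y])]]%SET.
Proof.
rewrite /mass (exchange_big_dep
  (mem [set c : clause n | [exists y, Q y && (val c == [set x; y])]]%SET)) /=; last first.
  by move=> y c Qy; rewrite !inE => cE; apply/existsP; exists y; rewrite Qy.
apply: eq_bigr => c; rewrite inE => /existsP[y /andP[Qy /eqP cE]].
rewrite (big_pred1 y) // => z; rewrite inE [val c]cE /=.
apply/andP/eqP => [[_ /eqP /set2_inj] //|->].
by rewrite Qy.
Qed.

Lemma sum_mass_pair_mem (x : literal n) :
  \sum_y mass P (pair_clauses x y) = mass P [set c : clause n | x \in val c]%SET.
Proof.
rewrite sum_mass_pair_cond; congr mass; apply/setP => c; rewrite !inE.
apply/existsP/idP => [[y /eqP ->]|/clause_mem_pair[y cE]]; first by rewrite !inE eqxx.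
by exists y; rewrite cE eqxx.
Qed.

Lemma sum_mass_pair (x : literal n) : \sum_y mass P (pair_clauses x y) = n%:R^-1.
Proof. by rewrite sum_mass_pair_mem P_lit. Qed.

(** At most [2 * size vs] literals are forbidden targets, and each takes away at most [C / n ^ 2]
    from the mass [1 / n] of the clauses containing [neg x]. *)
Lemma mass_out_clauses (vs : seq 'I_n) (x : literal n) :
  n%:R^-1 - (2 * size vs)%:R * (C / n%:R ^+ 2) <= mass P (out_clauses vs x).
Proof.
have -> : mass P (out_clauses vs x) =
    \sum_(y : literal n | y.1 \notin vs) mass P (pair_clauses (neg x) y).
  by rewrite sum_mass_pair_cond.
rewrite -(sum_mass_pair (neg x)) (bigID (fun y : literal n => y.1 \in vs)) /=.
rewrite -addrA [in leLHS]addrC -addrA gerDl addrC subr_le0.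
apply: (@le_trans _ _ (\sum_(y : literal n | y.1 \in vs) C / n%:R ^+ 2)).
  by apply: ler_sum => y _; apply: mass_pair_le.
rewrite sumr_const -[leLHS]mulr_natl; apply: ler_wpM2r; first exact: bound_ge0.
rewrite ler_nat mulnC.
have -> : #|[pred y : literal n | y.1 \in vs]| = (#|[pred v | v \in vs]| * #|{: bool}|)%N.
  rewrite -cardX; apply: eq_card => y; rewrite !inE /=.
  by rewrite andbT.
by rewrite card_bool leq_mul2r; apply/orP; right; apply: card_size.
Qed.

(** The sets of outgoing clauses are disjoint: such a clause has exactly one literal over [vs], the
    negation of its source, and the sources have distinct variables. *)
Lemma mass_outs (vs : seq 'I_n) (S : seq (literal n)) :
  uniq (map fst S) -> {subset map fst S <= vs} ->
  (size S)%:R * (n%:R^-1 - (2 * size vs)%:R * (C / n%:R ^+ 2)) <=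
  mass P [set c | has (fun x => c \in out_clauses vs x) S]%SET.
Proof.
elim: S => [|x S IH] /=; first by rewrite mul0r mass_ge0.
move=> /andP[xS uS] sub.
have {IH} := IH uS (fun v vS => sub v (mem_behead (s := x.1 :: _) vS)).
set W := [set c | _]%SET => IH.
have -> : [set c | (c \in out_clauses vs x) || has (fun x0 => c \in out_clauses vs x0) S]%SET
    = out_clauses vs x :|: W by apply/setP => c; rewrite !inE.
rewrite mass_setU; last first.
  apply/pred0P => c /=; apply/negP; rewrite !inE => /andP[/existsP[y /andP[yvs /eqP cE]]].
  move=> /hasP[x' x'S]; rewrite inE => /existsP[y' /andP[y'vs /eqP cE']].
  have : neg x \in val c by rewrite cE !inE eqxx.
  rewrite cE' !inE => /orP[/eqP/neg_inj xx'|/eqP xy'].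
    by move: xS; rewrite xx' map_f.
  by move: y'vs; rewrite -xy' /= sub ?inE ?eqxx.
by rewrite -natr1 mulrDl mul1r addrC lerD ?mass_out_clauses.
Qed.

End Regular.

(** * Long implication chains by depth-first search *)

Section DFS.
Variables (R : realType) (n m : nat) (P : clause n -> R) (C : R).
Hypothesis P_ge0 : forall c, 0 <= P c.
Hypothesis P_total : mass P [set: clause n]%SET = 1.
Hypothesis P_lit : forall x, mass P [set c : clause n | x \in val c]%SET = n%:R^-1.
Hypothesis P_le : forall c, P c <= C / n%:R ^+ 2.

(** The search queries the clauses with index in [D] and stops with a path of [2 * h] literals or
    after visiting [N] variables; the clauses outside [D] are reserved. The slope [b] belongs to the
    potential, and [gamma] bounds from below the chance that a clause lies inside a half chain. *)
Variables (D : {set 'I_m}) (N h : nat) (b gamma : R).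
Hypothesis N_le : (N <= n)%N.
Hypothesis b01 : 0 < b <= 1.
Hypothesis gamma01 : 0 <= gamma <= 1.
Hypothesis dense : forall s : seq (literal n), uniq (map fst s) ->
  sorted (fun x y : literal n => linked P x.1 y.1) s -> (h <= size s)%N ->
  gamma <= mass P [set c : clause n | [forall l in val c, l \in s]]%SET.

(** A lower bound for the probability that a clause leads from an exhausted literal to an unvisited
    variable, once [N] variables are visited and fewer than [2 * h] of them are on the path. *)
Let w0 : R := (N - 2 * h)%:R * (n%:R^-1 - (2 * N)%:R * (C / n%:R ^+ 2)).
Hypothesis deg_ge0 : 0 <= n%:R^-1 - (2 * N)%:R * (C / n%:R ^+ 2).
(* [kappa^-1] bounds the probability that the search visits [N] variables
   without finding a chain of length [2 * h], and [tau] the probability that the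
   reserved clauses do not contradict such a chain. *)
Let kappa : R := b ^+ N * (1 + (1 - b) * w0) ^+ (#|D| - N).
Let tau : R := ((1 - gamma) ^+ #|~: D|) *+ 2.

(* During the search [I j] is known to lie in [A j]: [K] is the set of indices
   whose clause has been revealed, [st] the current path with its last literal
   in front, [S] the literals whose outgoing clauses are exhausted. The indices
   outside [D] are never inspected. *)
Definition dfs_inv (A : 'I_m -> {set clause n}) (K : {set 'I_m})
    (st S : seq (literal n)) : Prop :=
  [/\ uniq (map fst (st ++ S)),
      sorted (fun y x => [exists j in K, A j \subset pair_clauses (neg x) y]) st,
      (forall j x c, j \in D -> j \notin K -> x \in S -> c \in A j ->
         c \notin out_clauses (map fst (st ++ S)) x),
      (K \subset D) && (#|K| <= size (st ++ S))%N &
      forall j, j \notin D -> A j = [set: clause n]%SET].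

(* A potential: it is affine in the mass of [A j], with the same slope [b] before
   and after [j] is revealed, so that the product over [j] is preserved by a query
   when summed over its outcomes. *)
Definition bernoulli_factor (A : 'I_m -> {set clause n}) (K : {set 'I_m}) (j : 'I_m) : R :=
  if j \in K then b * mass P (A j) else 1 - b * (1 - mass P (A j)).

Lemma mass_le1 (A : {set clause n}) : mass P A <= 1.
Proof. by rewrite -P_total; apply: mass_sub => //; apply: finset.subsetT. Qed.

Lemma bernoulli_factor_ge0 A K j : 0 <= bernoulli_factor A K j.
Proof.
rewrite /bernoulli_factor; have := mass_le1 (A j); have := mass_ge0 P_ge0 (A j).
move: b01 => /andP[b0 b1]; case: ifP => _ m0 m1; first by rewrite mulr_ge0 // ltW.
nra.
Qed.

(** Truth propagates along the chain. A satisfied clause inside the first part makes the last [h]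
    literals true, and one inside their negations makes one of these false; so the reserved clauses
    of a satisfiable instance all avoid one of the two kinds. *)
Lemma path_found A K st S : dfs_inv A K st S -> (2 * h <= size st)%N ->
  box_weight P A (@satisfiable n m) <= tau * \prod_j mass P (A j).
Proof.
case=> uq so _ /andP[KD _] AT szst.
have [hst hdrop] : (h <= size st)%N /\ (h <= size st - h)%N by move: szst; clear; lia.
have tau0 : 0 <= tau.
  by move/andP: gamma01 => [? ?]; rewrite /tau mulrn_wge0 // exprn_ge0 // subr_ge0.
(* If some [A j] has mass zero, the weight is zero. Otherwise every edge of the path carries a
   clause of positive probability, as [linked] demands. *)
have [/existsP[j /eqP mj]|/existsPn /= mpos] := boolP [exists j, mass P (A j) == 0].
  apply: le_trans (box_weight_eq0 P_ge0 _ mj) _.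
  by rewrite mulr_ge0 // prodr_ge0 // => i _; apply: mass_ge0.
have {}mpos j : 0 < mass P (A j) by rewrite lt0r mpos mass_ge0.
have link : sorted (fun x y : literal n => linked P x.1 y.1) st.
  apply: sub_sorted so => y x /exists_inP[j _ /subsetP sub].
  have [c /sub cA Pc] := mass_gt0_ex P_ge0 (mpos j).
  move: cA; rewrite inE => /eqP cE; apply/existsP; exists c.
  by rewrite Pc (clause_vars_pair cE) setUC /=.
have uqst : uniq (map fst st) by move: uq; rewrite map_cat cat_uniq => /andP[].
(* As [st] lists the chain backwards, [U1] is the chain without its last [h] literals, and [U2]
   consists of the negations of these. *)
pose U1 := drop h st; pose U2 := map (@neg n) (take h st).
pose cl (U : seq (literal n)) := [set c : clause n | [forall l in val c, l \in U]]%SET.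
have m1 : gamma <= mass P (cl U1).
  apply: dense; first by rewrite map_drop drop_uniq.
    exact: drop_sorted.
  by rewrite size_drop.
have m2 : gamma <= mass P (cl U2).
  apply: dense.
  - have -> : map fst U2 = take h (map fst st) by rewrite -map_take -map_comp.
    exact: take_uniq.
  - by rewrite sorted_map /=; apply: take_sorted.
  - by rewrite size_map size_takel.
pose avoid U : pred {ffun 'I_m -> clause n} :=
  fun I => [forall j, (j \notin D) ==> (I j \notin cl U)].
apply: (@le_trans _ _ (box_weight P A (predU (avoid U1) (avoid U2)))).
  apply: box_weight_le => // I IA _ /existsP[a /forallP sat].
  apply/andP; split; first exact/forallP.
  apply: contraT; rewrite negb_or => /andP[].
  move=> /forallPn[j1]; rewrite negb_imply negbK => /andP[_ c1].
  move=> /forallPn[j2]; rewrite negb_imply negbK => /andP[_ c2].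
  pose imp (y x : literal n) := lit_true a x ==> lit_true a y.
  have imps : sorted imp st.
    apply: sub_sorted so => y x /exists_inP[j _ /subsetP sub].
    have := sub _ (IA j); rewrite inE => /eqP cE.
    have := sat j; rewrite (clause_true_pair _ cE) lit_true_neg /imp.
    by case: (lit_true a x).
  have imp_tr : transitive imp.
    by move=> x y z; rewrite /imp; case: (lit_true a x); case: (lit_true a y); case: (lit_true a z).
  have : pairwise imp (take h st ++ drop h st) by rewrite cat_take_drop -sorted_pairwise.
  rewrite pairwise_cat => /and3P[/allrelP rel _ _].
  have /existsP[l1 /andP[l1c l1t]] := sat j1.
  have /existsP[l2 /andP[l2c l2t]] := sat j2.
  have l1U : l1 \in drop h st by move: c1; rewrite inE => /forall_inP; apply.
  have : l2 \in U2 by move: c2; rewrite inE => /forall_inP; apply.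
  move=> /mapP[y yst l2E]; have := rel _ _ yst l1U.
  by rewrite /imp l1t /=; move: l2t; rewrite l2E lit_true_neg => /negbTE ->.
apply: le_trans (box_weight_predU P_ge0 _ _ _) _.
have main U : gamma <= mass P (cl U) ->
    box_weight P A (avoid U) <= (1 - gamma) ^+ #|~: D| * \prod_j mass P (A j).
  move=> mU.
  (* Avoiding [U] confines each reserved clause to a set of mass at most [1 - gamma]. *)
  pose A' j := if j \in D then A j else ~: cl U.
  apply: (@le_trans _ _ (box_weight P A' predT)).
    apply: box_weight_le => // I IA _ /forallP av; rewrite andbT.
    apply/forallP => j; rewrite /A'; case: ifP => // /negbT jD.
    by rewrite inE; have := av j; rewrite jD.
  rewrite box_weightT.
  have -> : (1 - gamma) ^+ #|~: D| = \prod_j (if j \in D then 1 else 1 - gamma).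
    by rewrite (bigID (mem D)) /= big1 ?mul1r => [|j ->//];
      rewrite -prodr_const; apply: eq_big => j; rewrite inE // => /negbTE ->.
  rewrite -big_split /=; apply: ler_prod => j _; rewrite mass_ge0 //= /A'.
  case: ifP => [_|/negbT jD]; first by rewrite mul1r.
  by rewrite AT // P_total mulr1 mass_setC // lerD2l lerN2.
by rewrite /tau mulr2n mulrDl lerD ?main.
Qed.

(** At least [N - 2 * h] literals are exhausted, and each unrevealed clause of [D] avoids their
    outgoing clauses, so its set has mass at most [1 - w0]. There the potential gains a factor
    [1 + (1 - b) * w0] over the mass, against a loss of [b] for each of the at most [N] revealed
    clauses. *)
Lemma many_visited A K st S : dfs_inv A K st S -> (size st < 2 * h)%N ->
  size (st ++ S) = N ->
  box_weight P A (@satisfiable n m) <= kappa^-1 * \prod_j bernoulli_factor A K j.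
Proof.
case=> uq so ex /andP[KD Ksz] AT szst szN.
move/andP: (b01) => [b0 b1].
have w00 : 0 <= w0 by rewrite mulr_ge0.
have g0 : 0 < 1 + (1 - b) * w0 by rewrite ltr_wpDr // mulr_ge0 // subr_ge0.
have k0 : 0 < kappa by rewrite mulr_gt0 // exprn_gt0.
apply: (@le_trans _ _ (box_weight P A predT)).
  by apply: box_weight_le => // I IA _ _; rewrite andbT; apply/forallP.
rewrite box_weightT mulrC ler_pdivlMr //.
have mass0 j : 0 <= mass P (A j) by exact: mass_ge0.
pose g (j : 'I_m) := if j \in K then b else if j \in D then 1 + (1 - b) * w0 else 1.
apply: (@le_trans _ _ (\prod_j (mass P (A j) * g j))); last first.
  apply: ler_prod => j _; rewrite mulr_ge0 //=; last first.
    by rewrite /g; case: ifP => _; [exact: ltW|case: ifP => _ //; exact: ltW].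
  rewrite /g /bernoulli_factor; case: ifP => [_|/negbT jK]; first by rewrite mulrC.
  case: ifP => [jD|/negbT jD]; last first.
    by rewrite AT // P_total subrr mulr0 subr0 mulr1.
  (* The claim is [q * (1 + (1 - b) * w0) <= 1 - b * (1 - q)]; the difference of its sides is
     written as a sum of two nonnegative terms. *)
  suff wj : w0 <= 1 - mass P (A j).
    have := mass0 j; have := mass_le1 (A j); move: wj.
    set q := mass P (A j) => wj q1 q0.
    have : 0 <= q * (1 - b) * (1 - q - w0).
      by rewrite !mulr_ge0 ?subr_ge0.
    have : 0 <= (1 - b) * (1 - q) ^+ 2 by rewrite mulr_ge0 ?subr_ge0 ?sqr_ge0.
    move=> h1 h2; rewrite -subr_ge0.
    rewrite (_ : _ - _ = q * (1 - b) * (1 - q - w0) + (1 - b) * (1 - q) ^+ 2); last by ring.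
    exact: addr_ge0.
  pose W := [set c | has (fun x => c \in out_clauses (map fst (st ++ S)) x) S]%SET.
  have dis : [disjoint A j & W].
    apply/pred0P => c /=; apply/negP => /andP[cA]; rewrite inE => /hasP[x xS].
    by apply/negP; apply: ex cA.
  have uS : uniq (map fst S) by move: uq; rewrite map_cat cat_uniq => /and3P[].
  have subS : {subset map fst S <= map fst (st ++ S)}.
    by move=> v vS; rewrite map_cat mem_cat vS orbT.
  have := mass_outs P_ge0 P_total P_lit P_le uS subS; rewrite size_map szN.
  have := mass_le1 (A j :|: W); rewrite mass_setU // -/W => le1 leW.
  have : w0 <= mass P W.
    apply: le_trans leW; apply: ler_wpM2r => //; rewrite ler_nat.
    by move: szN szst; rewrite size_cat; clear; lia.
  lra.
rewrite big_split /=; apply: ler_wpM2l; first exact: prodr_ge0.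
have -> : \prod_j g j = b ^+ #|K| * (1 + (1 - b) * w0) ^+ #|D :\: K|.
  rewrite -!prodr_const (bigID (mem K)) /=; congr (_ * _).
    by apply: eq_bigr => j jK; rewrite /g jK.
  rewrite (bigID (mem D)) /= [X in _ * X]big1 ?mulr1.
    apply: eq_big => [j|j /andP[jK jD]]; first by rewrite !inE.
    by rewrite /g (negbTE jK) jD.
  by move=> j /andP[jK jD]; rewrite /g (negbTE jK) (negbTE jD).
have KN : (#|K| <= N)%N by rewrite -szN.
apply: ler_pM; rewrite ?exprn_ge0 ?(ltW g0) ?(ltW b0) //.
  by apply: ler_wiXn2l => //; exact: ltW.
apply: ler_weXn2l; first by rewrite lerDl mulr_ge0 // subr_ge0.
by rewrite cardsD (finset.setIidPr KD) leq_sub2l.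
Qed.

(** Only the factor at [j] changes: removing [Q] lowers it by [b] times the mass of [A j :&: Q],
    which is the total of the factors at [j] over the positive outcomes. *)
Lemma bernoulli_split (A : 'I_m -> {set clause n}) (K : {set 'I_m}) (j : 'I_m)
    (Q : {set clause n}) : j \notin K ->
  \prod_i bernoulli_factor A K i =
  \prod_i bernoulli_factor (update A j (A j :\: Q)) K i +
  \sum_(c in A j :&: Q) \prod_i bernoulli_factor (update A j [set c]%SET) (j |: K) i.
Proof.
move=> jK.
have tail (B : 'I_m -> {set clause n}) (K' : {set 'I_m}) : (forall i, i != j -> B i = A i /\ (i \in K') = (i \in K)) ->
  \prod_i bernoulli_factor B K' i =
  bernoulli_factor B K' j * \prod_(i | i != j) bernoulli_factor A K i.
  move=> e; rewrite (bigD1 j) //=; congr (_ * _); apply: eq_bigr => i /e[Bi Ki].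
  by rewrite /bernoulli_factor Bi Ki.
rewrite (tail A K) // (tail (update _ _ _) K); last by move=> i; rewrite /update => /negbTE ->.
rewrite [X in _ = _ + X](eq_bigr (fun c => b * P c *
  \prod_(i | i != j) bernoulli_factor A K i)); last first.
  move=> c _; rewrite tail; last by move=> i /negbTE ij; rewrite /update !inE ij.
  by rewrite /bernoulli_factor !inE eqxx /= /update eqxx mass_set1.
rewrite -big_distrl -mulrDl -big_distrr /= -/(mass P (A j :&: Q)); congr (_ * _).
rewrite /bernoulli_factor (negbTE jK) /update eqxx (mass_setD P (A j) Q).
ring.
Qed.

Lemma mass_split (A : 'I_m -> {set clause n}) (j : 'I_m) (Q : {set clause n}) :
  \prod_i mass P (A i) = \prod_i mass P (update A j (A j :\: Q) i) +
  \sum_(c in A j :&: Q) \prod_i mass P (update A j [set c]%SET i).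
Proof.
rewrite -!box_weightT (box_weight_split P A predT j Q); congr (_ + _).
by apply: eq_bigr => c _; rewrite box_weightT.
Qed.

(** Visiting more variables only removes outgoing clauses, so an exhausted literal stays
    exhausted. *)
Lemma out_clauses_sub (vs vs' : seq 'I_n) (x : literal n) : {subset vs <= vs'} ->
  {subset out_clauses vs' x <= out_clauses vs x}.
Proof.
move=> sub c; rewrite !inE => /existsP[y /andP[yvs cE]]; apply/existsP; exists y.
by rewrite cE andbT; apply: contra yvs => /sub.
Qed.

Lemma dfs_push A K S (x : literal n) : dfs_inv A K [::] S ->
  x.1 \notin map fst S -> dfs_inv A K [:: x] S.
Proof.
case=> uq _ ex /andP[KD Ksz] AT xS; split=> //=.
- by rewrite xS.
- move=> j y c jD jK yS cA; apply: contra (ex j y c jD jK yS cA).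
  by apply: out_clauses_sub => v vS /=; rewrite inE vS orbT.
- by rewrite KD (leq_trans Ksz).
Qed.

Lemma dfs_pop A K st S (x : literal n) : dfs_inv A K (x :: st) S ->
  (forall j, j \in D -> j \notin K ->
     [disjoint A j & out_clauses (map fst (x :: st ++ S)) x]) ->
  dfs_inv A K st (x :: S).
Proof.
case=> uq so ex /andP[KD Ksz] AT dis.
have pe : perm_eq (x :: st ++ S) (st ++ x :: S) by rewrite perm_sym perm_catC /= perm_cons perm_catC.
have pe1 := perm_map fst pe.
have sub : {subset map fst (x :: st ++ S) <= map fst (st ++ x :: S)}.
  by move=> v; rewrite (perm_mem pe1).
split=> //.
- by rewrite -(perm_uniq pe1).
- exact: path_sorted so.
- move=> j y c jD jK; rewrite inE => /orP[/eqP -> cA|yS cA].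
    apply/negP => /(out_clauses_sub sub) cO.
    by have /pred0P/(_ c) := dis j jD jK; rewrite /= cA cO.
  by apply: contra (ex j y c jD jK yS cA) => /(out_clauses_sub sub).
- by rewrite KD -(perm_size pe).
Qed.

Lemma dfs_no A K st S (j : 'I_m) (Q : {set clause n}) : dfs_inv A K st S ->
  j \in D -> j \notin K -> dfs_inv (update A j (A j :\: Q)) K st S.
Proof.
case=> uq so ex cK AT jD jK; split=> //.
- apply: sub_sorted so => y x /exists_inP[i iK Ai]; apply/exists_inP; exists i => //.
  by rewrite /update; case: (eqVneq i j) iK jK => // -> ->.
- move=> i y c iD iK yS; rewrite /update; case: (eqVneq i j) iD iK => [->|_] iD iK.
    by rewrite inE => /andP[_]; exact: ex.
  exact: ex.
- by move=> i iD; rewrite /update; case: (eqVneq i j) iD jD => [-> /negbTE ->|_ /AT].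
Qed.

(** A positive answer reveals one clause and visits one new variable, which keeps [#|K|] at most the
    number of visited literals. *)
Lemma dfs_yes A K st S (x : literal n) (j : 'I_m) (c : clause n) :
  dfs_inv A K (x :: st) S -> j \in D -> j \notin K ->
  c \in out_clauses (map fst (x :: st ++ S)) x ->
  exists y, dfs_inv (update A j [set c]%SET) (j |: K) (y :: x :: st) S.
Proof.
case=> uq so ex /andP[KD Ksz] AT jD jK; rewrite inE => /existsP[y /andP[yvs /eqP cE]].
exists y; split.
- by move: uq; rewrite /= => ->; rewrite andbT; exact: yvs.
- apply/andP; split.
    apply/exists_inP; exists j; first by rewrite !inE eqxx.
    by rewrite /update eqxx sub1set inE cE.
  apply: sub_path so => z w /exists_inP[i iK Ai]; apply/exists_inP; exists i.
    by rewrite inE iK orbT.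
  by rewrite /update; case: (eqVneq i j) iK jK => // -> ->.
- move=> i z d iD; rewrite in_setU1 negb_or => /andP[/negbTE ij iK] zS.
  rewrite /update ij => dA; apply: contra (ex i z d iD iK zS dA).
  by apply: out_clauses_sub => v vS /=; rewrite inE; apply/orP; right.
- rewrite finset.subUset sub1set jD KD /= cardsU1 jK /=.
  by rewrite add1n ltnS.
- by move=> i iD; rewrite /update; case: (eqVneq i j) iD jD => [-> /negbTE ->|_ /AT].
Qed.

(** When the search stops, one of the two terms suffices; before that, both sides split in the same
    way over the answers to a query. The measure drops by one at each new literal on the path, and
    by one at each backtrack. A new root also counts as a new literal. *)
Lemma dfs_bound k A K st S : dfs_inv A K st S -> (size (st ++ S) <= N)%N ->
  (2 * (N - size (st ++ S)) + size st < k)%N ->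
  box_weight P A (@satisfiable n m) <=
  kappa^-1 * \prod_j bernoulli_factor A K j + tau * \prod_j mass P (A j).
Proof.
move/andP: (b01) => [b0 b1]; move/andP: (gamma01) => [g0 g1].
have kappa0 : 0 <= kappa^-1.
  rewrite invr_ge0 mulr_ge0 ?exprn_ge0 ?(ltW b0) // addr_ge0 //.
  by rewrite mulr_ge0 ?subr_ge0 // /w0 mulr_ge0.
have tau0 : 0 <= tau by rewrite /tau mulrn_wge0 // exprn_ge0 // subr_ge0.
elim: k A K st S => // k IHk A K st S inv szN.
have [long|short] := leqP (2 * h) (size st).
  move=> _; apply: le_trans (path_found inv long) _; rewrite lerDr mulr_ge0 //.
  by apply: prodr_ge0 => j _; apply: bernoulli_factor_ge0.
have [full|] := eqVneq (size (st ++ S)) N.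
  move=> _; apply: le_trans (many_visited inv short full) _; rewrite lerDl mulr_ge0 //.
  by apply: prodr_ge0 => j _; apply: mass_ge0.
move=> ne; have {ne}szN : (size (st ++ S) < N)%N by rewrite ltn_neqAle ne.
case: st inv short szN => [|x st] inv _ szN.
  (* Fewer than [N <= n] variables are visited, so a fresh root exists. *)
  have [v vS] : exists v, v \notin map fst S.
    apply/existsP; rewrite -negb_forall; apply/negP => /forallP all.
    have := card_size (map fst S); rewrite size_map (eq_card (B := predT)); last first.
      by move=> v; rewrite inE all.
    rewrite card_ord => nS; have := leq_trans (leq_trans szN N_le) nS.
    by rewrite ltnn.
  move=> meas; have inv' := @dfs_push A K S (v, true) inv vS.
  by apply: (IHk _ _ _ _ inv'); move: szN meas; rewrite /=; clear; lia.
move=> meas.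
pose vs := map fst (x :: st ++ S).
(* An inner induction counts the unrevealed indices of [D] not yet known to avoid the clauses
   leaving [x]; when none is left, [x] is exhausted and popped. *)
pose todo (B : 'I_m -> {set clause n}) :=
  [set j in D :\: K | ~~ [disjoint B j & out_clauses vs x]]%SET.
have [t le_t] := ubnP #|todo A|; elim: t A le_t inv => // t IHt A le_t inv.
have [j|none] := pickP (mem (todo A)); last first.
  apply: (IHk A K st (x :: S)).
  - apply: dfs_pop inv _ => j jD jK.
    by have := none j; rewrite /= !inE jD jK /= => /negbFE.
  - by move: szN; rewrite !size_cat /=; clear; lia.
  - by move: szN meas; rewrite /= !size_cat /=; clear; lia.
rewrite /= !inE => /andP[/andP[jK jD] meets].
rewrite (box_weight_split P A _ j (out_clauses vs x)).
rewrite (bernoulli_split A (out_clauses vs x) jK) (mass_split A j (out_clauses vs x)).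
rewrite !mulrDr addrACA lerD //.
  apply: IHt; last exact: dfs_no.
  rewrite -ltnS; apply: leq_trans le_t; rewrite ltnS; apply: proper_card.
  apply/properP; split.
    apply/fintype.subsetP => i; rewrite !inE /update => /andP[->]; case: eqP => [->|//].
    by apply: contra => dis; apply: disjointWl dis; exact: subsetDl.
  exists j; first by rewrite !inE jK jD.
  rewrite !inE jK jD /= /update eqxx negbK.
  by apply/pred0P => c; rewrite /= in_setD; case: (c \in out_clauses vs x); rewrite ?andbF.
rewrite !mulr_sumr -big_split /=; apply: ler_sum => c; rewrite inE => /andP[_ cO].
have [y inv'] := dfs_yes inv jD jK cO.
by apply: (IHk _ _ _ _ inv'); move: szN meas; rewrite /= !size_cat /=; clear; lia.
Qed.

(** Initially nothing is revealed, and both products of the search bound equal 1. *)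
Lemma unsat_bound : (0 < N)%N ->
  box_weight P (fun _ => [set: clause n]%SET) (@satisfiable n m) <= kappa^-1 + tau.
Proof.
move=> N0; pose A (_ : 'I_m) := [set: clause n]%SET.
have inv : dfs_inv A (finset.set0) [::] [::].
  by split=> //; rewrite finset.sub0set cards0.
apply: le_trans (@dfs_bound _ A finset.set0 [::] [::] inv _ (ltnSn _)) _ => //.
rewrite [\prod_j bernoulli_factor _ _ _]big1 ?[\prod_j mass _ _]big1 ?mulr1 // => j _.
by rewrite /bernoulli_factor inE P_total subrr mulr0 subr0.
Qed.

End DFS.

(** * Bicycles in unsatisfiable instances *)

Lemma not_uniq_map_split (T U : eqType) (f : T -> U) (p : seq T) :
  ~~ uniq (map f p) -> exists p1, exists y, exists p2, exists z, exists p3,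
    p = p1 ++ y :: p2 ++ z :: p3 /\ f y = f z.
Proof.
elim: p => // y p IH /=; rewrite negb_and negbK => /orP[/mapP[z zp yz]|/IH].
  exists [::], y; case/splitPr: zp => p2 p3.
  by exists p2, z, p3.
by move=> [p1 [x [p2 [z [p3 [-> xz]]]]]]; exists (y :: p1), x, p2, z, p3.
Qed.

Lemma first_repeat (T U : eqType) (f : T -> U) (p q : seq T) :
  uniq (map f p) -> ~~ uniq (map f (p ++ q)) -> exists q1, exists b, exists q2,
    [/\ q = q1 ++ b :: q2, uniq (map f (p ++ q1)) & f b \in map f (p ++ q1)].
Proof.
elim: q p => [|y q IH] p up; first by rewrite cats0 up.
have [yp _|yp] := boolP (f y \in map f p).
  by exists [::], y, q; rewrite cats0.
rewrite -cat_rcons => /IH[]; first by rewrite map_rcons rcons_uniq yp.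
move=> q1 [b [q2 [-> u bin]]]; exists (y :: q1), b, q2.
by rewrite -(cat_rcons y p q1).
Qed.

Section Implications.
Variables (n m : nat) (I : {ffun 'I_m -> clause n}).

Definition imp_rel : rel (literal n) :=
  fun x y => [exists j, I j \in pair_clauses (neg x) y].

Lemma imp_rel_neg x y : imp_rel x y = imp_rel (neg y) (neg x).
Proof. by apply: eq_existsb => j; rewrite !inE negK setUC. Qed.

Lemma connect_neg x y : connect imp_rel x y = connect imp_rel (neg y) (neg x).
Proof.
suff imp z t : connect imp_rel z t -> connect imp_rel (neg t) (neg z).
  by apply/idP/idP => /imp //; rewrite !negK.
move=> /connectP[p + ->]; elim: p z => [|u p IH] z /=; first by rewrite connect0.
move=> /andP[zu /IH h]; apply: connect_trans h (connect1 _).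
by rewrite -imp_rel_neg.
Qed.

(** The literals [x] and [neg x] lie in the same strongly connected component. *)
Definition contradictory x := connect imp_rel x (neg x) && connect imp_rel (neg x) x.

(** A partial assignment, given by its true literals, that is closed under implication. *)
Definition closed_consistent (G : {set literal n}) : bool :=
  [forall x in G, (neg x \notin G) && [forall y, imp_rel x y ==> (y \in G)]].

Lemma closed_consistentP (G : {set literal n}) : reflect
  ((forall x, x \in G -> neg x \notin G) /\
   (forall x y, x \in G -> connect imp_rel x y -> y \in G)) (closed_consistent G).
Proof.
apply: (iffP forall_inP) => [h|[h1 h2] x xG]; last first.
  rewrite h1 //=; apply/forallP => y; apply/implyP => xy.
  exact: h2 xG (connect1 xy).
split=> [x /h /andP[]//|x y + /connectP[p + ->]].
elim: p x => [|z p IH] x xG //= /andP[xz]; apply: IH.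
by have /andP[_ /forallP/(_ z)] := h x xG; rewrite xz.
Qed.

(** The classical criterion for two-literal clauses: without contradictory literals, a largest
    closed consistent set decides every variable and yields a satisfying assignment. *)
Lemma unsat_contradictory : ~~ satisfiable I -> exists x, contradictory x.
Proof.
apply: contraNP => none.
have good0 : closed_consistent finset.set0 by apply/forall_inP => x; rewrite inE.
case: (@arg_maxnP _ finset.set0 closed_consistent (fun G : {set literal n} => #|G|) good0) => G.
move=> /closed_consistentP[Gc Gi] Gmax.
(* An undecided [x] implies [neg x], for otherwise the literals reachable from [x] could be added to
   [G]. Used for both [x] and [neg x], this makes [x] contradictory. *)
have half (x : literal n) : x \notin G -> neg x \notin G -> connect imp_rel x (neg x).
  move=> xG nxG; apply: contraT => ncon.
  pose H := G :|: [set y | connect imp_rel x y]%SET.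
  suff /Gmax le : closed_consistent H.
    have {le} : (#|H| <= #|G|)%N by exact: le.
    rewrite leqNgt => /negP[]; apply: proper_card; apply/properP.
    split; first exact: subsetUl.
    by exists x => //; rewrite !inE connect0 orbT.
  apply/closed_consistentP; split=> [y|y z].
    rewrite !inE => yH; apply/negP => nyH.
    (* If [x] reached the negation of a literal [t] of [G], then by contraposition [t] would reach
       [neg x], which is outside [G]. *)
    have sep t : t \in G -> connect imp_rel x (neg t) -> False.
      move=> tG; rewrite connect_neg negK => tx.
      by move: nxG; rewrite (Gi _ _ tG tx).
    case/orP: yH => yH; case/orP: nyH => nyH.
    - by move: (Gc y yH); rewrite nyH.
    - exact: sep yH nyH.
    - by apply: (sep _ nyH); rewrite negK.
    - move/negP: ncon; apply; apply: connect_trans yH _.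
      by move: nyH; rewrite [connect _ x _]connect_neg negK.
  rewrite !inE => /orP[yG yz|xy yz]; first by rewrite (Gi y).
  by rewrite (connect_trans xy yz) orbT.
have full (x : literal n) : (x \in G) || (neg x \in G).
  apply: contraT; rewrite negb_or => /andP[xG nxG]; case: none; exists x.
  by rewrite /contradictory half //= -{2}(negK x) half // negK.
apply/existsP; exists [ffun v => (v, true) \in G]; apply/forallP => j.
have litG (x : literal n) : x \in G -> lit_true [ffun v => (v, true) \in G] x.
  case: x => v [] xG; rewrite /lit_true ffunE /= ?xG //.
  by have := Gc _ xG; rewrite /neg /= => /negbTE ->.
have [x [y cE]] := clause_pairP (I j).
rewrite (clause_true_pair _ cE); have := full x => /orP[/litG -> //|nxG].
apply/orP; right; apply/litG/(Gi _ _ nxG)/connect1/existsP; exists j.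
by rewrite inE negK cE.
Qed.

(** Shorten the path while a variable repeats. Between two equal literals the detour is cut out;
    between [y] and [neg y] the segment itself becomes the path, and the rest of the cycle leads
    from [neg y] back to [y]. *)
Lemma contradictory_simple k a p : (size p < k)%N -> contradictory a ->
  path imp_rel a p -> last a p = neg a -> exists a', exists p',
  [/\ contradictory a', path imp_rel a' p', last a' p' = neg a' & uniq (map fst p')].
Proof.
elim: k a p => // k IH a p szp ca pp lp.
have [u|] := boolP (uniq (map fst p)); first by exists a, p.
move=> /not_uniq_map_split[p1 [y [p2 [z [p3 [pE yz]]]]]].
have [yzE|yzE] := same_var (esym yz).
  apply: (IH a (p1 ++ y :: p3)) => //.
  - by move: szp; rewrite pE !size_cat /= size_cat /=; clear; lia.
  - move: pp; rewrite pE yzE !cat_path /= cat_path /=.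
    by case/and4P => -> -> _ /andP[_ ->].
  - by move: lp; rewrite pE yzE !last_cat /= !last_cat.
move: (pp); rewrite pE cat_path /= cat_path /= => /and4P[ap1 p1y yp2 /andP[p2z zp3]].
have p2z' : path imp_rel y (rcons p2 z) by rewrite rcons_path yp2.
apply: (IH y (rcons p2 z)) => //; last by rewrite last_rcons.
  by move: szp; rewrite pE size_rcons size_cat /= size_cat /=; clear; lia.
rewrite /contradictory -yzE; apply/andP; split.
  by apply/connectP; exists (rcons p2 z) => //; rewrite last_rcons.
apply: (@connect_trans _ _ (neg a)).
  by apply/connectP; exists p3 => //; rewrite -lp pE last_cat /= last_cat.
case/andP: ca => _ /connect_trans; apply.
by apply/connectP; exists (rcons p1 y); rewrite ?last_rcons // rcons_path ap1.
Qed.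

(** Follow a path from [a] to [neg a] on distinct variables, then a path back to [a], up to the
    first repeated variable; there is one because the variable of [a] comes back. *)
Lemma unsat_bicycle : ~~ satisfiable I -> exists a, exists w, exists b,
  [/\ uniq (map fst w), neg a \in w, b.1 \in map fst w & path imp_rel a (rcons w b)].
Proof.
move=> /unsat_contradictory[x cx].
case/andP: (cx) => /connectP[p0 pp0 lp0] _.
have [a [p [/andP[_ /connectP[q pq lq]] pp lp up]]] :=
  contradictory_simple (ltnSn _) cx pp0 (esym lp0).
have nap : neg a \in p.
  case: p lp {pp up} => [/= /esym/eqP|y p /= <-]; first by rewrite neg_neq.
  exact: mem_last.
have aq : a \in q.
  case: q lq {pq} => [/= /eqP|y q /= ->]; first by rewrite eq_sym neg_neq.
  exact: mem_last.
have nu : ~~ uniq (map fst (p ++ q)).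
  rewrite map_cat cat_uniq negb_and negb_and negbK; apply/orP; right; apply/orP; left.
  by apply/hasP; exists a.1; [exact: map_f|apply/mapP; exists (neg a)].
have [q1 [b [q2 [qE u bin]]]] := first_repeat up nu.
exists a, (p ++ q1), b; split=> //; first by rewrite mem_cat nap.
move: pq; rewrite -lp qE cat_path => /andP[pq1 /= /andP[lb _]].
by rewrite rcons_path cat_path pp pq1 last_cat.
Qed.

End Implications.

Definition bicycle_clauses (n : nat) (a : literal n) (w : seq (literal n))
    (b : literal n) : seq {set clause n} :=
  pairmap (fun x y => pair_clauses (neg x) y) a (rcons w b).

(** Distinct steps need distinct clauses, which lets the probability of a bicycle be bounded by a
    product. Since the variables of [w] are distinct, only the last step, ending in [b], requires
    care. *)
Lemma bicycle_disjoint (n : nat) (a b : literal n) (w : seq (literal n)) :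
  uniq (map fst w) -> neg a \in w ->
  pairwise (fun X Y : {set clause n} => [disjoint X & Y]) (bicycle_clauses a w b).
Proof.
move=> uw naw.
have varE i j : (i < size w)%N -> (j < size w)%N ->
    (nth a w i).1 = (nth a w j).1 -> i = j.
  move=> iw jw; rewrite -!(nth_map a a.1 fst) // => /eqP.
  by rewrite nth_uniq ?size_map // => /eqP.
apply/(pairwiseP finset.set0) => i j; rewrite !inE size_pairmap size_rcons => iw jw ij.
rewrite !(nth_pairmap a) ?size_rcons //.
have iw' : (i < size w)%N by apply: leq_trans ij _; rewrite -ltnS.
case: j jw ij => // j jw ij.
have jw' : (j < size w)%N by rewrite -ltnS.
rewrite /= [nth _ (rcons w b) i]nth_rcons iw' [nth _ (rcons w b) j]nth_rcons jw'.
apply/pred0P => c /=; apply/negP => /andP[]; rewrite !inE => /eqP cE /eqP cE'.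
have : nth a w i \in val c by rewrite cE !inE eqxx orbT.
rewrite cE' !inE => /orP[/eqP e|/eqP e].
  have ijE : i = j by apply: varE => //; rewrite e.
  by move/eqP: e; rewrite ijE eq_sym neg_neq.
have [jlt|jge] := ltnP j.+1 (size w).
  move: e; rewrite nth_rcons jlt => /(congr1 fst)/(varE _ _ iw' jlt) ijE.
  by move: ij; rewrite ijE ltnn.
(* The later step is the last one and [b] is the end of the earlier step. The two steps then have
   the same source, which is possible only if the earlier one starts from [a]. *)
have : neg (nth a (a :: rcons w b) i) \in val c by rewrite cE !inE eqxx.
rewrite cE' !inE => /orP[/eqP/neg_inj e'|/eqP e']; last first.
  by have := val_clause_pair cE; rewrite e' -e eqxx.
case: i iw ij iw' e e' cE => [|i] iw ij iw' e e' cE /=; last first.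
  have iw2 : (i < size w)%N by apply: ltnW.
  move: e'; rewrite /= nth_rcons iw2 => /(congr1 fst)/(varE _ _ iw2 jw') ijE.
  by move: ij; rewrite ijE ltnn.
(* Now [a] itself is in [w], and so is [neg a], against the distinctness of the variables. *)
move: naw; rewrite /= in e'; rewrite {1}e' => /(nthP a)[k kw kE].
have kj : k = j by apply: varE => //; rewrite kE.
by move/eqP: kE; rewrite kj eq_sym neg_neq.
Qed.

(** * The expected number of bicycles *)

Section Hits.
Variables (R : realType) (T : finType) (P : T -> R) (m : nat).
Hypothesis P_ge0 : forall x, 0 <= P x.

Lemma box_weight_union (K : finType) (A : 'I_m -> {set T}) (E : pred {ffun 'I_m -> T})
    (F : K -> pred {ffun 'I_m -> T}) :
  (forall I, E I -> [exists k, F k I]) -> box_weight P A E <= \sum_k box_weight P A (F k).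
Proof.
move=> EF; rewrite /box_weight big_mkcond.
under [leRHS]eq_bigr => k _ do rewrite big_mkcond.
rewrite exchange_big /=; apply: ler_sum => I _.
have w0 : 0 <= \prod_j P (I j) by exact: prodr_ge0.
have s0 k : 0 <= (if [forall j, I j \in A j] && F k I then \prod_j P (I j) else 0).
  by case: ifP.
case: ifP => [/andP[IA /EF/existsP[k Fk]]|_]; last exact: sumr_ge0.
rewrite (bigD1 k) //= IA Fk /= lerDl; apply: sumr_ge0 => i _.
by have := s0 i; rewrite IA.
Qed.

Definition hits (Cs : seq {set T}) : pred {ffun 'I_m -> T} :=
  fun I => all (fun X : {set T} => [exists j, I j \in X]) Cs.

(** Union bound over the index [j] of a clause hitting the first set. Confined to that set, it can
    hit none of the others; hence the alternative required of [A j]. *)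
Lemma hits_bound (A : 'I_m -> {set T}) (Cs : seq {set T}) :
  mass P [set: T]%SET = 1 ->
  pairwise (fun X Y : {set T} => [disjoint X & Y]) Cs ->
  (forall j, A j = [set: T]%SET \/ all (fun X : {set T} => [disjoint A j & X]) Cs) ->
  box_weight P A (hits Cs) <= \prod_(X <- Cs) (m%:R * mass P X) * \prod_j mass P (A j).
Proof.
move=> total; elim: Cs A => [|X Cs IH] A.
  rewrite big_nil mul1r -box_weightT => _ _.
  by apply: box_weight_le => // I IA _ _; rewrite andbT; apply/forallP.
rewrite pairwise_cons => /andP[/allP Xdis pw] Adis.
pose F (j : 'I_m) : pred {ffun 'I_m -> T} := fun I => (I j \in X) && hits Cs I.
apply: le_trans (box_weight_union (F := F) _ _) _.
  move=> I /andP[/existsP[j IX] hCs]; apply/existsP; exists j.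
  by rewrite /F IX.
have step j : box_weight P A (F j) <=
    mass P X * \prod_(Y <- Cs) (m%:R * mass P Y) * \prod_i mass P (A i).
  case: (Adis j) => [Aj|]; last first.
    move=> /= /andP[AX _]; apply: (@le_trans _ _ 0).
      apply: (@le_trans _ _ (box_weight P A pred0)); last first.
        by rewrite /box_weight big1 // => I; rewrite andbF.
      apply: box_weight_le => // I IA _ /andP[IX _].
      by have /pred0P/(_ (I j)) := AX; rewrite /= IA IX.
    apply: mulr_ge0; last by apply: prodr_ge0 => i _; apply: mass_ge0.
    apply: mulr_ge0; first exact: mass_ge0.
    by apply: prodr_ge0 => Y _; rewrite mulr_ge0 ?mass_ge0.
  apply: (@le_trans _ _ (box_weight P (update A j X) (hits Cs))).
    apply: box_weight_le => // I IA _ /andP[IX ->]; rewrite andbT.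
    by apply/forallP => i; rewrite /update; case: eqVneq => [->|].
  apply: le_trans (IH _ pw _) _.
    move=> i; rewrite /update; case: eqVneq => _; first by right; apply/allP.
    by case: (Adis i) => [|/= /andP[]]; [left|right].
  rewrite [in leLHS](bigD1 j) //= {1}/update eqxx [in leRHS](bigD1 j) //= Aj total mul1r.
  rewrite (eq_bigr (fun i => mass P (A i))) => [|i ij]; last by rewrite /update (negbTE ij).
  by rewrite mulrA [_ * mass P X]mulrC.
apply: le_trans (ler_sum _ (fun j _ => step j)) _.
by rewrite sumr_const card_ord big_cons -[leLHS]mulr_natl !mulrA.
Qed.

End Hits.

Lemma big_tuple_cons (R : nmodType) (T : finType) (s : nat) (F : s.+1.-tuple T -> R) :
  \sum_(w : s.+1.-tuple T) F w = \sum_x \sum_(w : s.-tuple T) F [tuple of x :: w].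
Proof.
rewrite pair_big /= (reindex (fun p : T * s.-tuple T => [tuple of p.1 :: p.2])) //=.
exists (fun w => (thead w, [tuple of behead w])) => [[x w] _|w _] /=.
  by congr (_, _); apply: val_inj.
by rewrite -tuple_eta.
Qed.

(** Telescoping: [c ^ 2 - (N + c) ^ 2 * rho ^ N] grows at each step by at least [(1 - rho) / 2]
    times the new term. *)
Lemma quadratic_geometric_bound (R : realType) (rho : R) : 0 <= rho < 1 ->
  exists K : R, forall N, \sum_(s < N) (s.+1%:R) ^+ 2 * rho ^+ s <= K.
Proof.
move=> /andP[rho0 rho1].
have [c0 c0E] : exists c0 : nat, 6 / (1 - rho) <= c0%:R.
  by exists (Num.truncn (6 / (1 - rho))).+1; apply/ltW/truncnS_gt.
(* For [u = N + c] this gives [(1 - rho) * u ^ 2 / 2 >= 3 * u >= 2 * u + 1], the cost of passing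
   from [u ^ 2] to [(u + 1) ^ 2]. *)
have [c [cE c6]] : exists c : R, 6 <= c * (1 - rho) /\ 6 <= c.
  have cE : 6 <= c0%:R * (1 - rho) by rewrite -ler_pdivrMr ?subr_gt0.
  exists c0%:R; split=> //; apply: le_trans cE _.
  by rewrite ler_piMr // gerBl.
exists (2 / (1 - rho) * c ^+ 2) => N.
have claim : \sum_(s < N) (s.+1%:R) ^+ 2 * rho ^+ s * ((1 - rho) / 2) <=
    c ^+ 2 - (N%:R + c) ^+ 2 * rho ^+ N.
  elim: N => [|N IH]; first by rewrite big_ord0 add0r expr0 mulr1 subrr.
  rewrite big_ord_recr /=; set u : R := N%:R + c.
  have N0 : 0 <= N%:R :> R by [].
  have u6 : 6 <= u * (1 - rho) by rewrite /u; nra.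
  have rN : 0 <= rho ^+ N by apply: exprn_ge0.
  have key : N.+1%:R ^+ 2 * ((1 - rho) / 2) <= u ^+ 2 - rho * (u + 1) ^+ 2.
    have Nu : N.+1%:R <= u by rewrite -natr1 /u; lra.
    have : N.+1%:R ^+ 2 <= u ^+ 2 by rewrite lerXn2r // ?nnegrE // (le_trans _ Nu).
    have u0 : 6 <= u by rewrite /u; lra.
    have d0 : 0 < 1 - rho by rewrite subr_gt0.
    nra.
  have : N.+1%:R ^+ 2 * ((1 - rho) / 2) * rho ^+ N <= (u ^+ 2 - rho * (u + 1) ^+ 2) * rho ^+ N.
    by rewrite ler_wpM2r.
  have -> : N.+1%:R + c = u + 1 by rewrite -natr1 /u; ring.
  rewrite (exprS rho); move: IH; rewrite -/u.
  move: (rho ^+ N) (\sum_(s < N) _) => z S; clearbody u; move=> h1 h2.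
  have -> : (u + 1) ^+ 2 * (rho * z) = rho * (u + 1) ^+ 2 * z by ring.
  have -> : N.+1%:R ^+ 2 * z * ((1 - rho) / 2) = N.+1%:R ^+ 2 * ((1 - rho) / 2) * z by ring.
  by move: h2; rewrite mulrBl; lra.
move: claim; rewrite -mulr_suml -ler_pdivlMr; last by rewrite divr_gt0 // subr_gt0.
move/le_trans; apply; rewrite invf_div mulrC ler_wpM2l //.
  by rewrite divr_ge0 // subr_ge0 ltW.
by rewrite gerBl mulr_ge0 ?sqr_ge0 ?exprn_ge0.
Qed.

Section FirstMoment.
Variables (R : realType) (n m : nat) (P : clause n -> R) (C : R).
Hypothesis P_ge0 : forall c, 0 <= P c.
Hypothesis P_total : mass P [set: clause n]%SET = 1.
Hypothesis P_lit : forall x, mass P [set c : clause n | x \in val c]%SET = n%:R^-1.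
Hypothesis P_le : forall c, P c <= C / n%:R ^+ 2.

(** Each further literal, summed over all choices, contributes [m] times the mass [1 / n] of the
    clauses containing the negation of its predecessor. *)
Lemma sum_chain (s : nat) (x : literal n) :
  \sum_(w : s.-tuple (literal n))
    \prod_(X <- pairmap (fun x y => pair_clauses (neg x) y) x w) (m%:R * mass P X)
  = (m%:R / n%:R) ^+ s.
Proof.
elim: s x => [|s IH] x.
  rewrite (big_pred1 [tuple]) ?big_nil // => w.
  by apply/esym/eqP/val_inj; exact: size0nil (size_tuple w).
rewrite big_tuple_cons exprS.
under eq_bigr => y _.
  under eq_bigr => w _ do rewrite /= big_cons.
  rewrite -big_distrr /= IH; over.
by rewrite -big_distrl -big_distrr /= (sum_mass_pair P_lit).
Qed.

(** The two end clauses, whose outer variables already occur in the chain, are bounded by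
    [C / n ^ 2] each; only the inner chain is kept for summation. *)
Lemma bicycle_weight (a x b : literal n) (w : seq (literal n)) :
  uniq (map fst (x :: w)) -> neg a \in x :: w ->
  box_weight P (fun _ => [set: clause n]%SET) (@hits _ m (bicycle_clauses a (x :: w) b)) <=
  (m%:R * (C / n%:R ^+ 2)) ^+ 2 *
    \prod_(X <- pairmap (fun x y => pair_clauses (neg x) y) x w) (m%:R * mass P X).
Proof.
move=> uw aw; have dis := bicycle_disjoint b uw aw.
apply: le_trans (hits_bound P_ge0 P_total dis _) _; first by move=> _; left.
rewrite [\prod_j _]big1 ?mulr1; last by move=> j _.
rewrite /bicycle_clauses /= big_cons -cats1 pairmap_cat big_cat big_seq1 /=.
have m0 : 0 <= m%:R :> R by [].
have le z t : m%:R * mass P (pair_clauses z t) <= m%:R * (C / n%:R ^+ 2).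
  by rewrite ler_wpM2l // (mass_pair_le P_ge0 P_total P_le).
have ge0 X : 0 <= m%:R * mass P X by rewrite mulr_ge0 ?mass_ge0.
set Z := \prod_(X <- _) _.
have Z0 : 0 <= Z by apply: prodr_ge0.
rewrite (mulrC Z) [leLHS]mulrA expr2; apply: ler_wpM2r => //; exact: ler_pM.
Qed.

(** First moment over bicycles, coded by a chain of [s + 1] literals, the positions in it of [neg a]
    and of the variable of [b], and the sign of [b]. The constant comes from [2 * n] first literals
    and [2 * (s + 1) ^ 2] codes. *)
Lemma sat_bound :
  box_weight P (fun _ => [set: clause n]%SET) (fun I => ~~ @satisfiable n m I) <=
  4 * C ^+ 2 / n%:R * (m%:R / n%:R) ^+ 2 *
  \sum_(s < n) (s.+1%:R) ^+ 2 * (m%:R / n%:R) ^+ s.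
Proof.
pose F (s : 'I_n) (k : s.+1.-tuple (literal n) * ('I_s.+1 * ('I_s.+1 * bool))) :
    pred {ffun 'I_m -> clause n} := fun I =>
  uniq (map fst k.1) && hits (bicycle_clauses (neg (tnth k.1 k.2.1)) k.1
    ((tnth k.1 k.2.2.1).1, k.2.2.2)) I.
apply: le_trans (box_weight_union (F := fun s I => [exists k, @F s k I]) P_ge0 _ _) _.
  move=> I /unsat_bicycle[a [w [b [uw naw bw pw]]]].
  have szw : (size w <= n)%N.
    have := card_uniqP uw; rewrite size_map => <-.
    by rewrite -[leqRHS](card_ord n) max_card.
  case: w naw uw bw pw szw => // x w naw uw bw pw szw.
  apply/existsP; exists (Ordinal szw).
  pose t : (size w).+1.-tuple (literal n) := [tuple of x :: in_tuple w].
  have /tnthP[i iE] : neg a \in t by [].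
  have [y yt yE] := mapP bw.
  have /tnthP[k kE] : y \in t by [].
  apply/existsP; exists (t, (i, (k, b.2))); apply/andP; split; first exact: uw.
  rewrite -iE negK -kE -yE -surjective_pairing /hits.
  move: pw; rewrite /bicycle_clauses; move: (rcons _ _) => u.
  elim: u a {naw iE} => //= z u IH a' /andP[/existsP[j jP] /IH ->].
  by rewrite andbT; apply/existsP; exists j.
rewrite [leRHS]mulr_sumr; apply: ler_sum => s _.
apply: le_trans (box_weight_union (F := @F s) P_ge0 _ _) _ => //.
pose G (w : s.+1.-tuple (literal n)) : R := (m%:R * (C / n%:R ^+ 2)) ^+ 2 *
    \prod_(X <- pairmap (fun x y => pair_clauses (neg x) y) (thead w) (behead w))
       (m%:R * mass P X).
apply: (@le_trans _ _ (\sum_(k : s.+1.-tuple (literal n) * ('I_s.+1 * ('I_s.+1 * bool))) G k.1)).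
  apply: ler_sum => -[w [i [k sg]]] _ /=.
  have G0 : 0 <= G w.
    rewrite mulr_ge0 ?sqr_ge0 // prodr_ge0 // => X _.
    by rewrite mulr_ge0 ?mass_ge0.
  have [uw|nuw] := boolP (uniq (map fst w)); last first.
    by rewrite /F /box_weight big1 // => I; rewrite /= (negbTE nuw) andbF.
  have wE : tval w = thead w :: behead w by rewrite {1}(tuple_eta w).
  apply: le_trans (bicycle_weight (a := neg (tnth w i)) ((tnth w k).1, sg) _ _).
  - apply: box_weight_le => // I IA _ /andP[_ hI].
    by apply/andP; split; [exact/forallP|rewrite -wE].
  - by rewrite -wE.
  - by rewrite negK -wE mem_tnth.
rewrite -(pair_big predT predT (fun w _ => G w)) /=.
under eq_bigr => w _ do rewrite sumr_const.
rewrite sumrMnl big_tuple_cons /G.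
under eq_bigr => x _.
  under eq_bigr => w _ do rewrite theadE /=.
  rewrite -big_distrr /= sum_chain; over.
rewrite sumr_const !card_prod !card_ord card_bool -!mulrnA -[leLHS]mulr_natl.
have n0R : n%:R != 0 :> R by rewrite pnatr_eq0 -lt0n (leq_ltn_trans (leq0n s)) ?ltn_ord.
rewrite le_eqVlt; apply/orP; left; apply/eqP.
by rewrite !natrM; move: (_ ^+ s) => z; field.
Qed.

End FirstMoment.

(** * Clauses along a regular graph; communities *)

Section RegularGraph.
Variables (R : realType) (n d : nat) (sigma : rel 'I_n) (A : {set clause n}).
Hypothesis sigma_irr : irreflexive sigma.
Hypothesis sigma_deg : forall u, #|sigma u| = d.
Hypothesis mem_A : forall (c : clause n) x y, val c = [set x; y]%SET ->
  (c \in A) = sigma x.1 y.1.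
Hypothesis n_gt0 : (0 < n)%N.
Hypothesis d_gt0 : (0 < d)%N.

(** Both [P2] and [P11] have this form, for regular graphs on the variables of degrees [n / B - 1]
    and [n - n / B]. *)
Let P : clause n -> R := uniform R A.

Lemma regular_ge0 c : 0 <= P c.
Proof. by rewrite divr_ge0. Qed.

Lemma regular_A_gt0 : (0 < #|A|)%N.
Proof.
have /card_gt0P[v uv] : (0 < #|sigma (Ordinal n_gt0)|)%N by rewrite sigma_deg.
pose x : literal n := (Ordinal n_gt0, true); pose y : literal n := (v, true).
have xy : x.1 != y.1 by apply: contraTneq uv => /= <-; rewrite -topredE /= sigma_irr.
by apply/card_gt0P; exists (mkclause xy); rewrite (mem_A (x := x) (y := y)).
Qed.

Lemma regular_total : mass P [set: clause n]%SET = 1.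
Proof.
rewrite /mass /P /uniform -mulr_suml -natr_sum.
rewrite (_ : (\sum_(x in _) _)%N = #|A|) ?divff ?pnatr_eq0 -?lt0n ?regular_A_gt0 //.
by rewrite -sum1_card [RHS]big_mkcond; apply: eq_big => [c|c _]; rewrite ?inE //; case: (c \in A).
Qed.

Lemma regular_pair x y :
  mass P (pair_clauses x y) = (sigma x.1 y.1)%:R / #|A|%:R.
Proof.
have [xy|xy] := eqVneq x.1 y.1.
  rewrite xy sigma_irr mul0r /mass big1 // => c; rewrite inE => /eqP cE.
  by have := val_clause_pair cE; rewrite xy eqxx.
have -> : pair_clauses x y = [set mkclause xy]%SET.
  by apply/setP => c; rewrite !inE; apply/eqP/eqP => [cE|->//]; apply: val_inj.
by rewrite mass_set1 /P /uniform (mem_A (x := x) (y := y)).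
Qed.

Lemma regular_mem_mass x :
  mass P [set c : clause n | x \in val c]%SET = (2 * d)%:R / #|A|%:R.
Proof.
rewrite -sum_mass_pair_mem.
under eq_bigr => y _ do rewrite regular_pair.
rewrite -mulr_suml -natr_sum; congr (_%:R / _).
rewrite -(pair_big predT predT (fun v (_ : bool) => nat_of_bool (sigma x.1 v))) /=.
under eq_bigr => v _ do rewrite sum_nat_const card_bool.
rewrite -big_distrr /= -(sigma_deg x.1) -sum1_card [in RHS]big_mkcond /=.
by congr (_ * _)%N; apply: eq_bigr => v _; rewrite -topredE /=; case: sigma.
Qed.

Lemma sum_mem_mass (Q : clause n -> R) :
  \sum_x mass Q [set c : clause n | x \in val c]%SET = 2 * mass Q [set: clause n]%SET.
Proof.
rewrite /mass (exchange_big_dep (mem [set: clause n]%SET)) /=; last by move=> *; rewrite inE.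
rewrite mulr_sumr; apply: eq_bigr => c _.
rewrite (eq_bigl (mem (val c))); last by move=> x; rewrite inE.
rewrite sumr_const mulr_natl; congr (_ *+ _).
by have /andP[/eqP] := clauseP c.
Qed.

(** Double counting: the masses [2 * d / #|A|] of the [2 * n] literals add up to 2, because a clause
    has two literals. *)
Lemma regular_card : #|A| = (2 * n * d)%N.
Proof.
have := sum_mem_mass P; rewrite regular_total mulr1.
under eq_bigr => x _ do rewrite regular_mem_mass.
rewrite sumr_const card_prod card_ord card_bool -[LHS]mulr_natl mulrA -natrM.
move=> /(canRL (mulfVK _)); rewrite pnatr_eq0 -lt0n regular_A_gt0 => /(_ isT).
rewrite -natrM => /eqP; rewrite eqr_nat => /eqP; lia.
Qed.

Lemma regular_lit x : mass P [set c : clause n | x \in val c]%SET = n%:R^-1.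
Proof.
rewrite regular_mem_mass regular_card !natrM; field.
by rewrite !pnatr_eq0 -!lt0n n_gt0 d_gt0.
Qed.

Lemma regularE c : P c = (c \in A)%:R / (2 * n%:R * d%:R).
Proof. by rewrite /P /uniform regular_card !natrM. Qed.

End RegularGraph.

Section Communities.
Variables (n B : nat).
Let k := (n %/ B)%N.
Hypothesis Bn : (B %| n)%N.
Hypothesis k_gt0 : (0 < k)%N.

Definition comm (v : 'I_n) : nat := (v %/ (n %/ B))%N.

Lemma comm_lt v : (comm v < B)%N.
Proof. by rewrite /comm ltn_divLR // mulnC divnK. Qed.

Lemma in_community v (i : 'I_B) : (v \in community n i) = (comm v == i :> nat).
Proof. by rewrite inE -leq_divRL // -ltn_divLR // ltnS eqn_leq andbC. Qed.

Definition same_rel : rel 'I_n := fun u v => (u != v) && (comm u == comm v).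
Definition distinct_rel : rel 'I_n := fun u v => comm u != comm v.

Lemma card_comm u : #|[pred v | comm u == comm v]| = k.
Proof.
have lt (i : 'I_k) : (comm u * k + i < n)%N.
  have := comm_lt u; have := ltn_ord i; have := divnK Bn; rewrite -/k => <-.
  by move: (comm u) (i : nat) => a b; clear; nia.
pose f (i : 'I_k) : 'I_n := Ordinal (lt i).
have finj : injective f.
  by move=> i j /(congr1 val) /= /addnI ij; apply: val_inj.
rewrite -[RHS]card_ord -(card_image finj); apply: eq_card => v; rewrite !inE.
apply/eqP/imageP => [uv|[i _ ->]]; last first.
  by rewrite [RHS]/comm /= -/k divnMDl // divn_small ?addn0.
exists (Ordinal (ltn_pmod v k_gt0)) => //.
by apply: val_inj; rewrite /= uv /comm -/k -divn_eq.
Qed.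

Lemma same_rel_deg u : #|same_rel u| = k.-1.
Proof.
have := cardD1 u [pred v | comm u == comm v]; rewrite card_comm inE eqxx add1n => ->.
by rewrite /=; apply: eq_card => v; rewrite !inE /same_rel -topredE /= eq_sym.
Qed.

Lemma distinct_rel_deg u : #|distinct_rel u| = (n - k)%N.
Proof.
have := cardC [pred v | comm u == comm v]; rewrite card_comm card_ord.
rewrite (eq_card (B := distinct_rel u)); last by [].
by move: #|_| => a; clear; lia.
Qed.

Lemma same_communityE (c : clause n) x y : val c = [set x; y]%SET ->
  same_community B c = same_rel x.1 y.1.
Proof.
move=> cE; rewrite /same_rel (val_clause_pair cE) /= /same_community (clause_vars_pair cE).
apply/existsP/eqP => [[i]|xy].
  by rewrite finset.subUset !sub1set !in_community => /andP[/eqP -> /eqP ->].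
exists (Ordinal (comm_lt x.1)).
by rewrite finset.subUset !sub1set !in_community /= xy eqxx.
Qed.

Lemma distinct_communitiesE (c : clause n) x y : val c = [set x; y]%SET ->
  distinct_communities B c = distinct_rel x.1 y.1.
Proof.
move=> cE; rewrite /distinct_rel /distinct_communities (clause_vars_pair cE).
have meets (i : 'I_B) : ~~ [disjoint [set x.1; y.1]%SET & community n i] =
    (comm x.1 == i) || (comm y.1 == i).
  apply/pred0Pn/orP => [[v /= /andP[]]|].
    by rewrite in_community !inE => /orP[]/eqP -> ->; [left|right].
  by case=> xi; [exists x.1|exists y.1]; rewrite /= in_community xi !inE eqxx ?orbT.
apply/existsP/idP => [[i /existsP[j]]|xy].
  rewrite !meets => /and3P[ij xi xj]; apply: contra ij => /eqP xy.
  by move: xi xj; rewrite xy !orbb => /eqP xi /eqP xj; apply/eqP/val_inj; rewrite /= -xi -xj.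
exists (Ordinal (comm_lt x.1)); apply/existsP; exists (Ordinal (comm_lt y.1)).
by rewrite !meets /= !eqxx orbT !andbT.
Qed.

End Communities.

(** * The mixture *)

Definition inside (n : nat) (s : seq (literal n)) : {set clause n} :=
  [set c : clause n | [forall l in val c, l \in s]]%SET.

Lemma inside_sub (n : nat) (s s' : seq (literal n)) : {subset s <= s'} ->
  inside s \subset inside s'.
Proof.
move=> sub; apply/fintype.subsetP => c; rewrite !inE => /forall_inP h.
by apply/forall_inP => l /h /sub.
Qed.

(** Double counting over ordered pairs of literals of [s]: a clause inside [s] arises from at most
    two of them. *)
Lemma inside_mass (R : realType) (n : nat) (P : clause n -> R) (beta : R)
    (s : seq (literal n)) (theta : rel (literal n)) :
  (forall c, 0 <= P c) -> uniq s ->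
  {in s &, forall x y, theta x y -> beta <= mass P (pair_clauses x y)} ->
  beta * (\sum_(x <- s) count (theta x) s)%:R <= 2 * mass P (inside s).
Proof.
move=> P_ge0 us le; rewrite natr_sum mulr_sumr.
apply: (@le_trans _ _ (\sum_(x <- s)
    mass P [set c : clause n | [exists y, (y \in s) && (val c == [set x; y])]]%SET)).
  rewrite big_seq [leRHS]big_seq; apply: ler_sum => x xs.
  rewrite -sum_mass_pair_cond -big_uniq //= -sum1_count natr_sum mulr_sumr.
  rewrite big_mkcond big_seq [leRHS]big_seq; apply: ler_sum => y ys.
  by case: ifP => [xy|_]; [rewrite mulr1; exact: le|exact: mass_ge0].
rewrite big_uniq //= /mass (exchange_big_dep (mem (inside s))) /=; last first.
  move=> x c xs; rewrite !inE => /existsP[y /andP[ys /eqP cE]].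
  apply/forall_inP => l; have {}cE : val c = [set x; y]%SET by exact: cE.
  by rewrite [val c]cE !inE => /orP[]/eqP ->.
rewrite mulr_sumr; apply: ler_sum => c _; rewrite sumr_const -[leLHS]mulr_natl.
rewrite ler_wpM2r // ler_nat; have /andP[/eqP <- _] := clauseP c.
apply: subset_leq_card; apply/fintype.subsetP => x.
move=> /andP[_]; rewrite inE => /existsP[y /andP[_ /eqP cE]].
by rewrite [val c]cE !inE eqxx.
Qed.

Lemma alternating_count (T : Type) (g : T -> nat) (i : nat) (s : seq T) :
  sorted (fun x y => g x != g y) s -> (count (fun y => g y == i) s <= uphalf (size s))%N.
Proof.
(* The induction also records whether the preceding value is [i], in which case the next one is
   not. *)
have main x t : path (fun x y => g x != g y) x t ->
    (count (fun y => g y == i) t <= if g x == i then (size t)./2 else uphalf (size t))%N.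
  elim: t x => [|y t IH] x /=; first by case: ifP.
  move=> /andP[xy /IH]; have [gy|gy] := eqVneq (g y) i.
    by rewrite -gy (negbTE xy); lia.
  by case: ifP => _; lia.
case: s => //= x t /main; case: ifP => _; lia.
Qed.

Section Mixture.
Variables (R : realType) (p : R) (n B : nat).
Hypothesis p01 : 0 <= p <= 1.
Hypothesis B2 : (2 <= B)%N.
Hypothesis Bn : (B %| n)%N.
Hypothesis k2 : (2 <= n %/ B)%N.

Let P : clause n -> R := mixture p (P11 R B) (P2 R B).
Let k := (n %/ B)%N.

Let B_gt0 : (0 < B)%N. Proof. exact: leq_trans B2. Qed.
Let k_gt0 : (0 < k)%N. Proof. exact: leq_trans k2. Qed.
Let nE : n = (B * k)%N. Proof. by rewrite mulnC divnK. Qed.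
Let n_gt0 : (0 < n)%N. Proof. by rewrite {1}nE muln_gt0 B_gt0. Qed.
Let nk_gt0 : (0 < n - k)%N.
Proof. by rewrite {1}nE subn_gt0; move: k_gt0 B2; clear; nia. Qed.
Let k1_gt0 : (0 < k.-1)%N. Proof. by move: k2; rewrite -/k; case: k => [|[]]. Qed.

Let mem2 (c : clause n) x y : val c = [set x; y]%SET ->
  (c \in [set c | same_community B c]%SET) = same_rel B x.1 y.1.
Proof. by move=> cE; rewrite inE (same_communityE Bn k_gt0 cE). Qed.

Let mem11 (c : clause n) x y : val c = [set x; y]%SET ->
  (c \in [set c | distinct_communities B c]%SET) = distinct_rel B x.1 y.1.
Proof. by move=> cE; rewrite inE (distinct_communitiesE Bn k_gt0 cE). Qed.

Let irr2 : irreflexive (@same_rel n B).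
Proof. by move=> u; rewrite /same_rel eqxx. Qed.

Let irr11 : irreflexive (@distinct_rel n B).
Proof. by move=> u; rewrite /distinct_rel eqxx. Qed.

Let deg2 := same_rel_deg Bn k_gt0.
Let deg11 := distinct_rel_deg Bn k_gt0.

Lemma mass_mixture (A : {set clause n}) :
  mass P A = p * mass (P11 R B) A + (1 - p) * mass (P2 R B) A.
Proof. by rewrite /mass 2!mulr_sumr -big_split. Qed.

Lemma mixture_ge0 c : 0 <= P c.
Proof.
case/andP: p01 => p0 p1.
by rewrite addr_ge0 // mulr_ge0 ?subr_ge0 ?regular_ge0.
Qed.

Lemma mixture_total : mass P [set: clause n]%SET = 1.
Proof.
rewrite mass_mixture (regular_total R irr2 deg2 mem2) //.
by rewrite (regular_total R irr11 deg11 mem11) // !mulr1 addrC subrK.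
Qed.

Lemma mixture_lit x : mass P [set c : clause n | x \in val c]%SET = n%:R^-1.
Proof.
rewrite mass_mixture (regular_lit R irr2 deg2 mem2) //.
by rewrite (regular_lit R irr11 deg11 mem11) // -mulrDl addrC subrK mul1r.
Qed.

Let P2E (c : clause n) : P2 R B c = (same_community B c)%:R / (2 * n%:R * k.-1%:R).
Proof. by rewrite /P2 (regularE R irr2 deg2 mem2) // inE. Qed.

Let P11E (c : clause n) : P11 R B c = (distinct_communities B c)%:R / (2 * n%:R * (n - k)%:R).
Proof. by rewrite /P11 (regularE R irr11 deg11 mem11) // inE. Qed.

Let n0R : 0 < n%:R :> R. Proof. by rewrite ltr0n. Qed.

(** The supports have [2 * n * (k - 1)] and [2 * n * (n - k)] clauses, while [B >= 2] and [k >= 2]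
    give [n <= 2 * B * (k - 1)] and [n <= 2 * B * (n - k)]. *)
Lemma mixture_le c : P c <= B%:R / n%:R ^+ 2.
Proof.
case/andP: p01 => p0 p1.
have frac (b : bool) (d : nat) : (0 < d)%N -> (n <= B * (2 * d))%N ->
    b%:R / (2 * n%:R * d%:R) <= B%:R / n%:R ^+ 2 :> R.
  move=> d0 le; have d0R : 0 < d%:R :> R by rewrite ltr0n.
  apply: (@le_trans _ _ (1 / (2 * n%:R * d%:R))).
    by rewrite ler_wpM2r ?invr_ge0 ?mulr_ge0 //; case: b.
  rewrite ler_pdivlMr ?exprn_gt0 // mulrAC ler_pdivrMr ?mulr_gt0 // mul1r.
  move: le; rewrite -(ler_nat R) !natrM => le.
  have := ler_wpM2l (ltW n0R) le; rewrite expr2 => h; apply: le_trans h _.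
  by rewrite le_eqVlt; apply/orP; left; apply/eqP; ring.
rewrite /P /mixture P2E P11E.
apply: (@le_trans _ _ (p * (B%:R / n%:R ^+ 2) + (1 - p) * (B%:R / n%:R ^+ 2))).
  apply: lerD; apply: ler_wpM2l; rewrite ?subr_ge0 //; apply: frac => //.
    by rewrite {1 2}nE; move: B2 k_gt0; clear; nia.
  by rewrite {1}nE leq_mul2l; apply/orP; right; move: k1_gt0; clear; lia.
by rewrite -mulrDl addrC subrK mul1r.
Qed.

Let small_frac (d : nat) : (0 < d <= n)%N -> 1 / (2 * n%:R ^+ 2) <= 1 / (2 * n%:R * d%:R) :> R.
Proof.
move=> /andP[d0 dn]; have d0R : 0 < d%:R :> R by rewrite ltr0n.
rewrite !mul1r lef_pV2 ?posrE ?mulr_gt0 ?exprn_gt0 //.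
by rewrite expr2 mulrA ler_pM2l ?mulr_gt0 // ler_nat.
Qed.

Lemma mixture_same_ge (x y : literal n) : same_rel B x.1 y.1 ->
  (1 - p) / (2 * n%:R ^+ 2) <= mass P (pair_clauses x y).
Proof.
case/andP: p01 => p0 p1 xy.
rewrite mass_mixture (regular_pair R irr2 mem2) (regular_pair R irr11 mem11) xy.
rewrite (regular_card R irr2 deg2 mem2) // !natrM.
rewrite -[leLHS]add0r; apply: lerD; first by rewrite mulr_ge0 // divr_ge0.
apply: ler_wpM2l; rewrite ?subr_ge0 // -[leLHS]mul1r; apply: small_frac.
by rewrite k1_gt0 /=; apply: leq_trans (leq_pred _) (leq_div _ _).
Qed.

Lemma mixture_distinct_ge (x y : literal n) : distinct_rel B x.1 y.1 ->
  p / (2 * n%:R ^+ 2) <= mass P (pair_clauses x y).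
Proof.
case/andP: p01 => p0 p1 xy.
rewrite mass_mixture (regular_pair R irr2 mem2) (regular_pair R irr11 mem11) xy.
rewrite (regular_card R irr11 deg11 mem11) // !natrM.
rewrite -[leLHS]addr0; apply: lerD; last by rewrite mulr_ge0 ?subr_ge0 // divr_ge0.
apply: ler_wpM2l; rewrite ?subr_ge0 // -[leLHS]mul1r; apply: small_frac.
by rewrite nk_gt0 leq_subr.
Qed.

Lemma crowded_community (s : seq (literal n)) :
  exists i : 'I_B, (size s <= B * count (fun x => comm B x.1 == i) s)%N.
Proof.
apply/existsP; apply: contraT; rewrite negb_exists => /forallP /= lt.
have : (\sum_(i < B) B * count (fun x => comm B x.1 == i) s < \sum_(i < B) size s)%N.
  rewrite (bigD1 (Ordinal B_gt0)) //= [ltnRHS](bigD1 (Ordinal B_gt0)) //= -addSn.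
  apply: leq_add; first by rewrite ltnNge; exact: (lt (Ordinal B_gt0)).
  by apply: leq_sum => i _; apply: ltnW; rewrite ltnNge lt.
rewrite sum_nat_const card_ord -big_distrr /= ltn_mul2l B_gt0 /=.
suff -> : (\sum_(i < B) count (fun x => comm B x.1 == i) s = size s)%N by rewrite ltnn.
elim: s {lt} => [|x s IH] /=; first by rewrite big1.
rewrite big_split /= IH (bigD1 (Ordinal (comm_lt Bn k_gt0 x.1))) //= eqxx big1 //.
by move=> i ne; case: eqP => // xi; case/eqP: ne; apply: val_inj; rewrite /= xi.
Qed.

(** By pigeonhole some community holds [q >= h / B] literals of [s], and any two of them form a
    clause of the support of [P2]. The constant 8 gathers a 2 from the pair mass, a 2 from the
    double counting and a 2 from [q * (q - 1) >= q ^ 2 / 2]. *)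
Lemma dense_same (h : nat) (s : seq (literal n)) : uniq (map fst s) ->
  (2 * B <= h)%N -> (h <= size s)%N ->
  (1 - p) / (8 * B%:R ^+ 2) * (h%:R / n%:R) ^+ 2 <= mass P (inside s).
Proof.
case/andP: p01 => p0 p1 us hB hs.
have [i si] := crowded_community s.
pose t := [seq x <- s | comm B x.1 == i].
have tE : size t = count (fun x => comm B x.1 == i) s by rewrite size_filter.
have ut : uniq t by rewrite filter_uniq // (map_uniq us).
have ge : {in t &, forall x y, y != x -> (1 - p) / (2 * n%:R ^+ 2) <= mass P (pair_clauses x y)}.
  move=> x y; rewrite !mem_filter => /andP[/eqP xi xs] /andP[/eqP yi ys] yx.
  apply: mixture_same_ge; rewrite /same_rel xi yi eqxx andbT.
  apply: contra yx => /eqP xy; apply/eqP.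
  have := nth_index x xs; have := nth_index x ys.
  have ix : (index x s < size (map fst s))%N by rewrite size_map index_mem.
  have iy : (index y s < size (map fst s))%N by rewrite size_map index_mem.
  move=> yE xE; rewrite -yE -[RHS]xE; congr nth; apply/eqP.
  rewrite -(nth_uniq x.1 iy ix us) !(nth_map x) ?index_mem //.
  by rewrite xE yE xy.
have := inside_mass (theta := fun x y => y != x) mixture_ge0 ut ge.
have -> : (\sum_(x <- t) count (fun y => y != x) t = size t * (size t).-1)%N.
  rewrite big_seq (eq_bigr (fun _ => (size t).-1)).
    by rewrite -big_seq big_const_seq count_predT iter_addn_0 mulnC.
  move=> x xt; have := count_predC (pred1 x) t.
  by rewrite count_uniq_mem // xt => <-; rewrite add1n.
move=> le; have : mass P (inside t) <= mass P (inside s).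
  by apply: mass_sub; [exact: mixture_ge0|apply: inside_sub; exact: mem_subseq (filter_subseq _ _)].
have szt : (h <= B * size t)%N by rewrite tE (leq_trans hs).
have sz2 : (h * h <= B * B * (2 * (size t * (size t).-1)))%N.
  move: szt hB B_gt0; move: (size t) => q; clear.
  move=> szt hB B0; have q2 : (2 <= q)%N by nia.
  have : (h * h <= (B * q) * (B * q))%N by rewrite leq_mul.
  have : (q <= 2 * q.-1)%N by lia.
  nia.
move: (size t * (size t).-1)%N le sz2 => q le; rewrite -(ler_nat R) !natrM => sz2 le2.
set z : R := q%:R in sz2 le *.
have B0R : 0 < B%:R :> R by rewrite ltr0n.
have fin : (1 - p) / (8 * B%:R ^+ 2) * (h%:R / n%:R) ^+ 2 <= (1 - p) / (2 * n%:R ^+ 2) * z / 2.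
  have -> : (1 - p) / (8 * B%:R ^+ 2) * (h%:R / n%:R) ^+ 2 =
     (1 - p) / (8 * n%:R ^+ 2 * B%:R ^+ 2) * (h%:R * h%:R) by field; rewrite !gt_eqF.
  have -> : (1 - p) / (2 * n%:R ^+ 2) * z / 2 =
     (1 - p) / (8 * n%:R ^+ 2 * B%:R ^+ 2) * (B%:R * B%:R * (2 * z)) by field; rewrite !gt_eqF.
  apply: ler_wpM2l => //; rewrite divr_ge0 ?subr_ge0 // !mulr_ge0 //.
by apply: le_trans fin (le_trans _ le2); rewrite ler_pdivrMr // [leRHS]mulrC.
Qed.

(** Communities change at every step of [s], so each literal faces at least [(size s)./2] literals
    of other communities. The constant 16 gathers a 2 from the pair mass, a 2 from the double
    counting and a 4 from [h ^ 2 <= 4 * q * q./2], where [q] is the size of [s]. *)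
Lemma dense_distinct (h : nat) (s : seq (literal n)) : p = 1 ->
  uniq (map fst s) -> sorted (fun x y : literal n => linked P x.1 y.1) s ->
  (2 <= h)%N -> (h <= size s)%N ->
  1 / 16 * (h%:R / n%:R) ^+ 2 <= mass P (inside s).
Proof.
move=> p1 us so h2 hs.
have alt : sorted (fun x y : literal n => comm B x.1 != comm B y.1) s.
  apply: sub_sorted so => x y /existsP[c /andP[Pc /eqP cE]].
  have dc : distinct_communities B c.
    apply: contraTT Pc => /negbTE nd.
    by rewrite /P /mixture p1 P11E nd subrr !mul0r mulr0 addr0 ltxx.
  have [z [t zt]] := clause_pairP c.
  move: dc; rewrite (distinct_communitiesE Bn k_gt0 zt) /distinct_rel => zt'.
  move: cE; rewrite (clause_vars_pair zt) => e.
  have : z.1 \in [set x.1; y.1]%SET by rewrite -e !inE eqxx.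
  have : t.1 \in [set x.1; y.1]%SET by rewrite -e !inE eqxx orbT.
  rewrite !inE => /orP[]/eqP tE /orP[]/eqP zE; move: zt'; rewrite tE zE ?eqxx //.
  by rewrite eq_sym.
have ge : {in s &, forall x y, comm B y.1 != comm B x.1 ->
    p / (2 * n%:R ^+ 2) <= mass P (pair_clauses x y)}.
  by move=> x y _ _ xy; apply: mixture_distinct_ge; rewrite /distinct_rel eq_sym.
have := inside_mass (theta := fun x y : literal n => comm B y.1 != comm B x.1)
  mixture_ge0 (map_uniq us) ge.
have cnt : (size s * (size s)./2 <=
    \sum_(x <- s) count (fun y : literal n => comm B y.1 != comm B x.1) s)%N.
  have -> : (size s * (size s)./2 = \sum_(x <- s) (size s)./2)%N.
    by rewrite big_const_seq count_predT iter_addn_0 mulnC.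
  apply: leq_sum => x _.
  have := alternating_count (g := fun y : literal n => comm B y.1) (comm B x.1) alt.
  have := count_predC (fun y : literal n => comm B y.1 == comm B x.1) s.
  rewrite /predC /=; move: (count _ _) (count _ _) (size s) => a b c; clear; lia.
have sz2 : (h * h <= 4 * \sum_(x <- s)
    count (fun y : literal n => comm B y.1 != comm B x.1) s)%N.
  apply: leq_trans (leq_mul (leqnn 4) cnt); move: hs h2; move: (size s) => q; clear.
  move=> hs h2; have : (q <= 4 * q./2)%N by lia.
  nia.
move: sz2; rewrite -(ler_nat R) !natrM; set z : R := (\sum_(x <- s) _)%:R => sz2 le.
have fin : 1 / 16 * (h%:R / n%:R) ^+ 2 <= p / (2 * n%:R ^+ 2) * z / 2.
  rewrite p1.
  have -> : 1 / 16 * (h%:R / n%:R) ^+ 2 =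
     1 / (16 * n%:R ^+ 2) * (h%:R * h%:R) :> R by field; rewrite !gt_eqF.
  have -> : 1 / (2 * n%:R ^+ 2) * z / 2 =
     1 / (16 * n%:R ^+ 2) * (4 * z) :> R by field; rewrite !gt_eqF.
  by apply: ler_wpM2l => //; rewrite divr_ge0 // !mulr_ge0.
by apply: le_trans fin _; rewrite ler_pdivrMr // [leRHS]mulrC.
Qed.

End Mixture.

(** * Asymptotics *)

Section Transfer.
Variables (R : realType) (n m : nat) (P : clause n -> R).

Lemma Pr_box_weight (E : pred (instance n m)) (F : pred {ffun 'I_m -> clause n}) :
  (forall f : {ffun 'I_m -> clause n}, E [tuple f i | i < m] = F f) ->
  Pr (F_mass P) E = box_weight P (fun _ => [set: clause n]%SET) F.
Proof.
move=> EF; rewrite /Pr /box_weight.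
rewrite (reindex (fun f : {ffun 'I_m -> clause n} => [tuple f i | i < m])) /=; last first.
  exists (fun t : m.-tuple (clause n) => [ffun i => tnth t i]) => [f _|t _].
    by apply/ffunP => i; rewrite ffunE tnth_mktuple.
  by apply: eq_from_tnth => i; rewrite tnth_mktuple ffunE.
apply: eq_big => f.
  by rewrite EF; case: forallP => // -[] j; rewrite inE.
by move=> _; apply: eq_bigr => i _; rewrite tnth_mktuple.
Qed.

Lemma SAT_satisfiable (f : {ffun 'I_m -> clause n}) :
  SAT [tuple f i | i < m] = satisfiable f.
Proof.
apply: eq_existsb => a; apply/all_tnthP/forallP => h i.
  by have := h i; rewrite tnth_mktuple.
by rewrite tnth_mktuple.
Qed.

Lemma Pr_SAT_UNSAT : mass P [set: clause n]%SET = 1 ->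
  Pr (F_mass P) (@SAT n m) = 1 - Pr (F_mass P) (@UNSAT n m).
Proof.
move=> total.
have : Pr (F_mass P) (@SAT n m) + Pr (F_mass P) (@UNSAT n m) =
    Pr (F_mass P) (predT : pred (instance n m)).
  by rewrite /Pr [RHS](bigID (@SAT n m)).
have -> : Pr (F_mass P) (predT : pred (instance n m)) =
    box_weight P (fun _ : 'I_m => [set: clause n]%SET) predT by exact: Pr_box_weight.
by rewrite box_weightT big1 => [<-|//]; rewrite addrK.
Qed.

End Transfer.

(** * Elementary inequalities through the exponential *)

Section Numerics.
Variable R : realType.

(** The inequality [1 - 1 / y <= ln y], multiplied by [k] and exponentiated. *)
Lemma expR_le_pow (y : R) (k : nat) : 0 < y -> expR (k%:R * (1 - y^-1)) <= y ^+ k.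
Proof.
move=> y0; rewrite mulrC expRM_natr; apply: lerXn2r; rewrite ?nnegrE ?expR_ge0 ?(ltW y0) //.
have := expR_ge1Dx (y^-1 - 1); rewrite addrC subrK => le.
rewrite -[leLHS]invrK -expRN opprB -[leRHS]invrK lef_pV2 ?posrE ?invr_gt0 //.
exact: expR_gt0.
Qed.

Lemma pow_le_inv (g : R) (k : nat) : 0 < g <= 1 -> (0 < k)%N ->
  (1 - g) ^+ k <= (k%:R * g)^-1.
Proof.
move=> /andP[g0 g1] k0.
have kg0 : 0 < k%:R * g by rewrite mulr_gt0 // ltr0n.
apply: (@le_trans _ _ (expR (- (k%:R * g)))).
  rewrite -mulrN expRM_natl; apply: lerXn2r; rewrite ?nnegrE ?subr_ge0 ?expR_ge0 //.
  exact: expR_ge1Dx.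
rewrite expRN lef_pV2 ?posrE ?expR_gt0 //.
by apply: le_trans (expR_ge1Dx _); rewrite lerDr.
Qed.

(** In the exponent, the first factor loses at most [eps / 8 * (1 + eps / 4) * N] and the second
    gains at least [eps / 8 * (1 + 5 / 4 * eps) * N]. The surplus [eps ^ 2 / 8 * N] is kept to first
    order. *)
Lemma kappa_ge (eps w : R) (N M : nat) : 0 < eps <= 1 / 8 -> 0 <= w <= 1 ->
  (1 + 31 / 16 * eps) * (1 - eps / 8) ^+ 2 * N%:R <= M%:R * w ->
  1 + eps ^+ 2 / 8 * N%:R <= (1 - eps / 8) ^+ N * (1 + eps / 8 * w) ^+ M.
Proof.
move=> /andP[e0 e1] /andP[w0 w1] le.
have b0 : 0 < 1 - eps / 8 by lra.
have c0 : 0 < 1 + eps / 8 * w by rewrite ltr_wpDr // mulr_ge0 //; lra.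
apply: (@le_trans _ _ (expR (N%:R * (1 - (1 - eps / 8)^-1)) *
   expR (M%:R * (1 - (1 + eps / 8 * w)^-1)))); last first.
  by rewrite ler_pM ?expR_ge0 ?expR_le_pow.
rewrite -expRD; apply: le_trans (expR_ge1Dx _); rewrite lerD2l.
have N0 : 0 <= N%:R :> R by [].
have M0 : 0 <= M%:R :> R by [].
have e1' : 1 - (1 - eps / 8)^-1 >= - (eps / 8 * (1 + eps / 4)).
  suff : (1 - eps / 8)^-1 <= 1 + eps / 8 * (1 + eps / 4) by lra.
  rewrite -[leLHS]mul1r ler_pdivrMr //; nra.
have e2 : (1 + eps / 8)^-1 * (eps / 8 * w) <= 1 - (1 + eps / 8 * w)^-1.
  have -> : 1 - (1 + eps / 8 * w)^-1 = (1 + eps / 8 * w)^-1 * (eps / 8 * w).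
    move: c0; set v := 1 + eps / 8 * w => c0.
    have -> : eps / 8 * w = v - 1 by rewrite /v; ring.
    by rewrite mulrBr mulr1 mulVf // gt_eqF.
  apply: ler_wpM2r; first by rewrite mulr_ge0 //; lra.
  by rewrite lef_pV2 ?posrE //; nra.
have e3 : 1 - eps / 8 <= (1 + eps / 8)^-1.
  rewrite -[leRHS]mul1r ler_pdivlMr; [nra|lra].
have main : eps / 8 * (1 + eps / 4) * N%:R + eps ^+ 2 / 8 * N%:R <=
    M%:R * ((1 + eps / 8)^-1 * (eps / 8 * w)).
  apply: (@le_trans _ _ ((1 - eps / 8) * (eps / 8) * (M%:R * w))); last first.
    rewrite (_ : M%:R * _ = (1 + eps / 8)^-1 * (eps / 8) * (M%:R * w)); last by ring.
    apply: ler_wpM2r; first by rewrite mulr_ge0.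
    by apply: ler_wpM2r => //; lra.
  apply: (@le_trans _ _ ((1 - eps / 8) * (eps / 8) *
      ((1 + 31 / 16 * eps) * (1 - eps / 8) ^+ 2 * N%:R))); last first.
    by apply: ler_wpM2l => //; apply: mulr_ge0; lra.
  rewrite (_ : _ + _ = eps / 8 * N%:R * (1 + 5 / 4 * eps)); last by field.
  rewrite (_ : _ * (_ * N%:R) = eps / 8 * N%:R *
     ((1 + 31 / 16 * eps) * (1 - eps / 8) ^+ 3)); last by field.
  apply: ler_wpM2l; first by rewrite mulr_ge0 //; lra.
  have c3 : 1 - 3 / 8 * eps <= (1 - eps / 8) ^+ 3.
    rewrite (_ : (1 - eps / 8) ^+ 3 = 1 - 3 / 8 * eps + 3 / 64 * eps ^+ 2 - eps ^+ 3 / 512); last by field.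
    have : eps ^+ 3 <= eps ^+ 2 by rewrite (exprSr _ 2) ler_piMr ?sqr_ge0 //; lra.
    have : 0 <= eps ^+ 2 by apply: sqr_ge0.
    lra.
  apply: (@le_trans _ _ ((1 + 31 / 16 * eps) * (1 - 3 / 8 * eps))); first nra.
  by apply: ler_wpM2l => //; lra.
have := ler_wpM2l N0 e1'; have := ler_wpM2l M0 e2; move: main.
move: (M%:R * _) (M%:R * _) => x y; lra.
Qed.

End Numerics.

Lemma nat_floor (R : realType) (y : R) : 0 <= y ->
  exists k : nat, k%:R <= y /\ y < k%:R + 1.
Proof. by exists (Num.truncn y); rewrite truncn_le natr1 truncnS_gt. Qed.

(** The choice [delta = eps / (16 * C)] makes the visited variables use up at most a fraction
    [eps / 8] of the outgoing mass [1 / x]. *)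
Lemma free_degree_ge (R : realType) (eps delta C x : R) (N : nat) :
  0 < eps -> 0 < x -> 0 <= C -> delta * (16 * C) = eps -> N%:R <= delta * x ->
  (1 - eps / 8) * x^-1 <= x^-1 - (2 * N)%:R * (C / x ^+ 2).
Proof.
move=> e0 x0 C0 dE Nx; rewrite mulrBl mul1r lerB // natrM.
rewrite (_ : 2 * N%:R * (C / x ^+ 2) = 2 * C * N%:R / x * x^-1); last first.
  by field; rewrite gt_eqF.
apply: ler_wpM2r; first by rewrite invr_ge0 ltW.
rewrite ler_pdivrMr // -dE (_ : _ / 8 * x = 2 * C * (delta * x)); last by field.
by apply: ler_wpM2l => //; rewrite mulr_ge0.
Qed.

(** As [delta <= eps / 16], at least [(1 + 31 / 16 * eps) * x] of the [m1] clauses remain after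
    setting [N] aside. The two factors [1 - eps / 8] come from [N - 2 * h >= (1 - eps / 8) * N] and
    from the free degree. *)
Lemma kappa_inv_le (R : realType) (eps delta C x : R) (N h m1 : nat) :
  0 < eps -> eps <= 1 / 8 -> 0 < x -> 0 < delta -> delta <= eps / 16 ->
  delta * (16 * C) = eps -> 0 <= C ->
  delta * x / 2 <= N%:R -> N%:R <= delta * x -> 2 * h%:R <= N%:R * (eps / 8) ->
  (1 + 2 * eps) * x <= m1%:R ->
  ((1 - eps / 8) ^+ N * (1 + (1 - (1 - eps / 8)) *
     ((N - 2 * h)%:R * (x^-1 - (2 * N)%:R * (C / x ^+ 2)))) ^+ (m1 - N))^-1 <=
  16 / (eps ^+ 2 * delta) / x.
Proof.
move=> e0 e1 x0 d0 d1 dE C0 Nlow Nx h2N m1x.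
have deg := free_degree_ge e0 x0 C0 dE Nx.
have xV0 : 0 < x^-1 by rewrite invr_gt0.
have N0 : 0 <= N%:R :> R by [].
have c0 : 0 <= 1 - eps / 8 by lra.
have cx0 : 0 <= (1 - eps / 8) * x^-1 by rewrite mulr_ge0 // ltW.
set w := (N - 2 * h)%:R * _.
have dxx : delta * x <= 31 / 16 * eps * x - 30 / 16 * eps * x by nra.
have Nlx : N%:R <= x by nra.
have N2h : (2 * h <= N)%N.
  by rewrite -(ler_nat R) natrM; apply: le_trans h2N _; rewrite ler_piMr //; lra.
have w0 : (1 - eps / 8) ^+ 2 * N%:R * x^-1 <= w.
  rewrite /w (_ : _ * x^-1 = (1 - eps / 8) * N%:R * ((1 - eps / 8) * x^-1)); last by ring.
  apply: ler_pM => //; first exact: mulr_ge0.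
  by rewrite natrB // natrM; move: h2N; clear; lra.
have wpos : 0 <= w.
  by apply: le_trans w0; rewrite mulr_ge0 ?(ltW xV0) // mulr_ge0 // sqr_ge0.
have w1 : w <= 1.
  rewrite -(divff (lt0r_neq0 x0)); apply: ler_pM => //; first exact: le_trans deg.
    by rewrite (le_trans _ Nlx) // ler_nat leq_subr.
  by rewrite gerBl mulr_ge0 // divr_ge0 // exprn_ge0 // ltW.
have Nm1 : (N <= m1)%N.
  by rewrite -(ler_nat R); apply: le_trans Nlx (le_trans _ m1x); nra.
have key : (1 + 31 / 16 * eps) * (1 - eps / 8) ^+ 2 * N%:R <= (m1 - N)%:R * w.
  rewrite (_ : _ * N%:R = (1 + 31 / 16 * eps) * x * ((1 - eps / 8) ^+ 2 * N%:R * x^-1)).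
    apply: ler_pM => //.
    - by rewrite mulr_ge0 ?(ltW x0) //; lra.
    - by rewrite mulr_ge0 ?(ltW xV0) // mulr_ge0 // sqr_ge0.
    - by rewrite natrB //; lra.
  by field; rewrite gt_eqF.
have e01 : 0 < eps <= 1 / 8 by rewrite e0.
have w01 : 0 <= w <= 1 by rewrite wpos.
have := kappa_ge e01 w01 key; rewrite (_ : 1 - (1 - eps / 8) = eps / 8); last by ring.
have e20 : 0 < eps ^+ 2 by rewrite exprn_gt0.
move=> kap; rewrite -[leRHS]invrK lef_pV2 ?posrE.
- apply: le_trans kap; rewrite invfM invf_div invrK.
  have -> : eps ^+ 2 * delta / 16 * x = eps ^+ 2 / 8 * (delta * x / 2) by field.
  apply: (@le_trans _ _ (eps ^+ 2 / 8 * N%:R)); last by rewrite lerDr.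
  by apply: ler_wpM2l => //; rewrite divr_ge0 // ltW.
- by apply: lt_le_trans kap; rewrite ltr_pwDl // mulr_ge0 // divr_ge0 // ltW.
- by rewrite invr_gt0 divr_gt0 // divr_gt0 // mulr_gt0.
Qed.

(** * Failure probabilities of order [1 / n] on both sides of the threshold *)

Section Asymptotics.
Variables (R : realType) (p : R) (B : nat).
Hypothesis p01 : 0 <= p <= 1.
Hypothesis B2 : (2 <= B)%N.

Let P n : clause n -> R := mixture p (P11 R B) (P2 R B).

Lemma unsat_rare (rho : R) : 0 <= rho < 1 -> exists K : R, forall n m : nat,
  (B %| n)%N -> (2 <= n %/ B)%N -> m%:R / n%:R <= rho ->
  box_weight (@P n) (fun _ : 'I_m => [set: clause n]%SET) (fun I => ~~ satisfiable I) <= K / n%:R.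
Proof.
move=> rho01; have [K0 K0P] := quadratic_geometric_bound rho01.
exists (4 * B%:R ^+ 2 * K0) => n m Bn k2 mn.
have := (@sat_bound R n m (@P n) B%:R (mixture_ge0 B p01) (mixture_total p B2 Bn k2)
  (mixture_lit p B2 Bn k2) (mixture_le p01 B2 Bn k2)). move/le_trans; apply.
have q0 : 0 <= m%:R / n%:R :> R by rewrite divr_ge0.
case/andP: rho01 => rho0 rho1.
rewrite -mulrA [leRHS]mulrAC; apply: ler_wpM2l.
  by rewrite divr_ge0 // mulr_ge0 // sqr_ge0.
rewrite -[leRHS]mul1r; apply: ler_pM.
- exact: sqr_ge0.
- by apply: sumr_ge0 => s _; rewrite mulr_ge0 ?sqr_ge0 ?exprn_ge0.
- by rewrite expr_le1 // (le_trans mn) // ltW.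
- apply: le_trans (K0P n); apply: ler_sum => s _; apply: ler_wpM2l; first exact: sqr_ge0.
  by apply: lerXn2r.
Qed.

Lemma dense_mixture : exists2 c0 : R, 0 < c0 <= 1 & forall (n h : nat) (s : seq (literal n)),
  (B %| n)%N -> (2 <= n %/ B)%N -> uniq (map fst s) ->
  sorted (fun x y : literal n => linked (@P n) x.1 y.1) s ->
  (2 * B <= h)%N -> (h <= size s)%N ->
  c0 * (h%:R / n%:R) ^+ 2 <= mass (@P n) (inside s).
Proof.
case/andP: (p01) => p0 p1; have [p1E|pn1] := eqVneq p 1.
  exists (1 / 16); first by lra.
  move=> n h s Bn k2 us so hB hs; apply: dense_distinct => //.
  by move: hB B2; clear; lia.
have p1' : 0 < 1 - p by rewrite subr_gt0 lt_neqAle pn1.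
have B0 : 1 <= B%:R :> R by rewrite ler1n; apply: leq_trans B2.
have B8 : 8 <= 8 * B%:R ^+ 2 :> R by rewrite ler_peMr // exprn_ege1.
exists ((1 - p) / (8 * B%:R ^+ 2)).
  rewrite divr_gt0 //=; last by apply: lt_le_trans B8.
  by rewrite ler_pdivrMr; lra.
by move=> n h s Bn k2 us so hB hs; apply: dense_same.
Qed.

Lemma sat_rare (eps : R) : 0 < eps <= 1 / 8 -> exists K : R, exists n0 : R, forall n m : nat,
  n0 <= n%:R -> (B %| n)%N -> (2 <= n %/ B)%N -> (1 + 4 * eps) * n%:R <= m%:R ->
  box_weight (@P n) (fun _ : 'I_m => [set: clause n]%SET) (@satisfiable n m) <= K / n%:R.
Proof.
move=> /andP[e0 e1]; have [c0 /andP[c00 c01] dense] := dense_mixture.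
have B0 : 2 <= B%:R :> R by rewrite ler_nat.
pose delta := eps / (16 * B%:R).
have dE : delta * (16 * B%:R) = eps by rewrite divfK // gt_eqF //; lra.
have d0 : 0 < delta by rewrite divr_gt0 //; lra.
have d1 : delta <= eps / 16 by nra.
have ed0 : 0 < eps * delta by rewrite mulr_gt0.
(* The first term bounds the failure of the search, the second that of the reserved clauses. *)
exists (16 / (eps ^+ 2 * delta) + 2 / (eps * (c0 * (eps * delta / 32) ^+ 2))).
(* Beyond this threshold [eps * delta * n >= 32 * (2 + 2 * B)], which absorbs the roundings and
   ensures [h >= 2 * B]. *)
exists (32 * (2 + 2 * B%:R) / (eps * delta)) => n m.
rewrite ler_pdivrMr // => large Bn k2; move: large.
have [n0|n0] := eqVneq n 0%N; first by move: k2; rewrite n0 div0n.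
have x0 : 0 < n%:R :> R by rewrite ltr0n lt0n.
have [x xE] : exists x : R, n%:R = x by exists n%:R.
rewrite xE in x0 *; move=> large mx.
have dx0 : 0 <= delta * x by rewrite mulr_ge0 // ltW.
have dx2 : 64 <= delta * x by nra.
have ex2 : 64 <= eps * x by nra.
have [N [N1 N2]] := nat_floor dx0.
have Nhalf : delta * x / 2 <= N%:R by lra.
have N0 : 0 <= N%:R :> R by [].
have eN0 : 0 <= eps * N%:R / 16 by rewrite divr_ge0 // mulr_ge0 // ltW.
have [h [h1 h2]] := nat_floor eN0.
have h0 : 0 <= h%:R :> R by [].
have hlow : eps * delta / 32 * x <= h%:R by nra.
have hB : (2 * B <= h)%N by rewrite -(ler_nat R) natrM; nra.
have hN : h%:R <= N%:R :> R by nra.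
have h2N : 2 * h%:R <= N%:R * (eps / 8) by nra.
have Nx : N%:R <= x by nra.
have Nn : (N <= n)%N by rewrite -(ler_nat R) xE.
have m1pos : 0 <= (1 + 2 * eps) * x by nra.
(* The search receives about [(1 + 2 * eps) * n] clauses, and at least [eps * n] stay reserved. *)
have [m1 [m11 m12]] : exists m1 : nat,
    (1 + 2 * eps) * x < m1%:R /\ m1%:R <= (1 + 2 * eps) * x + 1.
  by have [k [k1 k2']] := nat_floor m1pos; exists k.+1; rewrite -(natr1 k); split; lra.
have m1m : (m1 <= m)%N by rewrite -(ler_nat R); nra.
have Nm1 : (N <= m1)%N by rewrite -(ler_nat R); nra.
pose D := [set j : 'I_m | (j < m1)%N]%SET.
have cD : #|D| = m1.
  rewrite -sum1_card (eq_bigl (fun j : 'I_m => (j < m1)%N)); last by move=> j; rewrite inE.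
  by rewrite -(big_ord_widen m (fun _ => 1%N)) // sum_nat_const card_ord muln1.
have cDC : #|~: D| = (m - m1)%N by rewrite cardsCs finset.setCK cD card_ord.
pose gamma := c0 * (h%:R / x) ^+ 2.
have hx : 0 <= h%:R / x <= 1.
  by rewrite divr_ge0 ?(ltW x0) //= ler_pdivrMr // mul1r (le_trans hN).
have hx2 : 0 <= (h%:R / x) ^+ 2 <= 1.
  by case/andP: hx => a b; rewrite sqr_ge0 expr_le1.
have g01 : 0 <= gamma <= 1 by rewrite /gamma; case/andP: hx2 => a b; nra.
have glow : c0 * (eps * delta / 32) ^+ 2 <= gamma.
  apply: ler_wpM2l; first exact: ltW.
  apply: lerXn2r; rewrite ?nnegrE; first by rewrite divr_ge0 // ltW.
    by case/andP: hx.
  by rewrite ler_pdivlMr.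
have eps8 : 0 < 1 - eps / 8 <= 1 by lra.
have dense' (s : seq (literal n)) : uniq (map fst s) ->
    sorted (fun x y : literal n => linked (@P n) x.1 y.1) s -> (h <= size s)%N ->
    gamma <= mass (@P n) [set c : clause n | [forall l in val c, l \in s]]%SET.
  by move=> us so hs; rewrite /gamma -xE; exact: dense.
have deg0 : 0 <= x^-1 - (2 * N)%:R * (B%:R / x ^+ 2).
  apply: le_trans (free_degree_ge e0 x0 _ dE N1); last by lra.
  by rewrite mulr_ge0 ?invr_ge0 ?(ltW x0) //; lra.
have N00 : (0 < N)%N by rewrite -(ltr_nat R); lra.
have := @unsat_bound R n m (@P n) B%:R (mixture_ge0 B p01) (mixture_total p B2 Bn k2)
  (mixture_lit p B2 Bn k2) (mixture_le p01 B2 Bn k2) D N h (1 - eps / 8) gamma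
  Nn eps8 g01 dense'.
rewrite xE => /(_ deg0 N00) /le_trans; apply.
rewrite [leRHS]mulrDl; apply: lerD.
  by rewrite cD; apply: (kappa_inv_le e0 e1 x0 d0 d1 dE) => //; exact: ltW.
have gl0 : 0 < c0 * (eps * delta / 32) ^+ 2.
  by rewrite mulr_gt0 // exprn_gt0 // divr_gt0.
have gpos : 0 < gamma by apply: lt_le_trans glow.
have H1 : eps * x <= (m - m1)%:R by rewrite natrB //; nra.
have Hpos : (0 < m - m1)%N by rewrite -(ltr_nat R); lra.
rewrite cDC -[leLHS]mulr_natl -[leRHS]mulrA; apply: ler_wpM2l => //.
have g01' : 0 < gamma <= 1 by rewrite gpos; case/andP: g01.
apply: le_trans (pow_le_inv g01' Hpos) _.
have lpos : 0 < eps * (c0 * (eps * delta / 32) ^+ 2) * x by rewrite mulr_gt0 // mulr_gt0.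
have rpos : 0 < (m - m1)%:R * gamma by rewrite mulr_gt0 // ltr0n.
rewrite -invfM lef_pV2 ?posrE //.
rewrite mulrAC; apply: ler_pM => //; first by rewrite mulr_ge0 // ltW.
exact: ltW.
Qed.

End Asymptotics.

(** * Limits along the multiples of [B], and the threshold *)

Local Open Scope classical_set_scope.
Local Open Scope ring_scope.

Lemma near_multiplesP (B : nat) (Q : nat -> Prop) :
  (\forall n \near multiples_oo B, Q n) <->
  exists n0, forall n, (n0 <= n)%N -> (B %| n)%N -> Q n.
Proof.
split=> [[n0 _ h]|[n0 h]]; first by exists n0 => n nn Bn; apply: h.
by exists n0 => // n nn Bn; apply: h.
Qed.

Lemma cvg_one_multiples (R : realType) (B : nat) (f : nat -> R) :
  (exists K : R, exists n0 : R, forall n, n0 <= n%:R -> (B %| n)%N -> `|1 - f n| <= K / n%:R) ->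
  f n @[n --> multiples_oo B] --> (1 : R).
Proof.
move=> [K [n0 h]]; have FF : Filter (multiples_oo B) by apply: within_filter.
apply/cvgrPdist_lt => e e0; apply/near_multiplesP.
exists (maxn 1 (maxn (Num.truncn n0).+1 (Num.truncn (K / e)).+1)) => n.
rewrite !geq_max => /and3P[n1 n2 n3] Bn.
have x0 : 0 < n%:R :> R by rewrite ltr0n.
apply: le_lt_trans (h n _ Bn) _.
  by apply: le_trans (ltW (truncnS_gt n0)) _; rewrite ler_nat.
rewrite ltr_pdivrMr // mulrC -ltr_pdivrMr //.
by apply: lt_le_trans (truncnS_gt _) _; rewrite ler_nat.
Qed.

Theorem theorem3p8 (R : realType) (p : R) (B : nat) (m : nat -> nat) (r : R)
    (hp : 0 <= p <= 1) (hB : (2 <= B)%N)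
    (hm : (m n)%:R / n%:R @[n --> multiples_oo B] --> r) :
  let P (n : nat) : clause n -> R := mixture p (P11 R B) (P2 R B) in
  (r < 1 -> whp B P (fun n => @SAT n (m n))) /\
  (1 < r -> whp B P (fun n => @UNSAT n (m n))).
Proof.
move=> P; have FF : Filter (multiples_oo B) by apply: within_filter.
have near_r (e : R) : 0 < e -> exists n0, forall n, (n0 <= n)%N -> (B %| n)%N ->
    `|r - (m n)%:R / n%:R| < e.
  by move=> e0; apply/near_multiplesP; move/cvgrPdist_lt: hm; apply.
have big n : (2 * B)%:R <= n%:R :> R -> (B %| n)%N -> (2 <= n %/ B)%N.
  by rewrite ler_nat => nB _; rewrite leq_divRL // (leq_trans _ hB).
split=> r1; apply: cvg_one_multiples.
(* The midpoint of [r] and 1 eventually dominates [m n / n]; the maximum with 0 secures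
   [0 <= rho]. *)
- pose rho := Num.max 0 ((r + 1) / 2).
  have rho01 : 0 <= rho < 1 by rewrite /rho le_max lexx gt_max ltr01 /=; lra.
  have [K KP] := unsat_rare hp hB rho01.
  have [|n0 n0P] := near_r ((1 - r) / 2); first by lra.
  (* The summand [2 * B] guarantees two variables in each community. *)
  exists K, (n0 + 2 * B)%:R => n nn Bn.
  have nB : (2 <= n %/ B)%N.
    by apply: big => //; apply: le_trans nn; rewrite ler_nat leq_addl.
  rewrite Pr_SAT_UNSAT ?mixture_total // opprB addrC subrK.
  rewrite (@Pr_box_weight R n (m n) (P n) _ (fun I => ~~ satisfiable I)); last first.
    by move=> f; rewrite /UNSAT SAT_satisfiable.
  rewrite ger0_norm; last by apply: box_weight_ge0 => c; apply: mixture_ge0.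
  apply: KP => //; rewrite le_max; apply/orP; right.
  have : `|r - (m n)%:R / n%:R| < (1 - r) / 2.
    apply: n0P Bn; move: nn; rewrite ler_nat; apply: leq_trans; exact: leq_addr.
  by rewrite ltr_norml => /andP[h _]; lra.
(* Then [1 + 4 * eps <= (r + 1) / 2], which [m n / n] eventually exceeds. *)
- pose eps := Num.min (1 / 8) ((r - 1) / 8).
  have eps01 : 0 < eps <= 1 / 8 by rewrite /eps lt_min ge_min lexx /= andbT; apply/andP; split; lra.
  have epsr : eps <= (r - 1) / 8 by rewrite /eps ge_min lexx orbT.
  have [K [x0 KP]] := sat_rare hp hB eps01.
  have [|n0 n0P] := near_r ((r - 1) / 2); first by lra.
  exists K, (Num.max x0 (n0 + 2 * B)%:R) => n; rewrite ge_max => /andP[nx nn] Bn.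
  have nB : (2 <= n %/ B)%N.
    by apply: big => //; apply: le_trans nn; rewrite ler_nat leq_addl.
  rewrite (_ : 1 - _ = Pr (F_mass (P n)) (@SAT n (m n))); last first.
    by rewrite Pr_SAT_UNSAT ?mixture_total.
  rewrite (@Pr_box_weight R n (m n) (P n) _ (@satisfiable n (m n))); last exact: SAT_satisfiable.
  rewrite ger0_norm; last by apply: box_weight_ge0 => c; apply: mixture_ge0.
  apply: KP => //.
  have npos : 0 < n%:R :> R.
    by apply: lt_le_trans nn; rewrite ltr0n addn_gt0 muln_gt0 (leq_trans _ hB) ?orbT.
  rewrite -ler_pdivlMr //.
  have : `|r - (m n)%:R / n%:R| < (r - 1) / 2.
    apply: n0P Bn; move: nn; rewrite ler_nat; apply: leq_trans; exact: leq_addr.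
  by rewrite ltr_norml => /andP[_ h]; lra.
Qed.
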